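(* Let $(\varphi_t)_{t\ge0}$ be a continuous semigroup of holomorphic self-maps of the unit disc $\mathbb{D}$. If for some $t_0>0$ the iterate $\varphi_{t_0}$ is a linear fractional self-map of $\mathbb{D}$, then $\varphi_t$ is a linear fractional self-map of $\mathbb{D}$ for all $t\ge0$.
   Context: $\mathbb{D}=\{z\in\mathbb{C}:|z|<1\}$. A (continuous) semigroup in $\mathbb{D}$ is a family $(\varphi_t)_{t\ge0}$ of holomorphic maps $\varphi_t:\mathbb{D}\to\mathbb{D}$ with $\varphi_0=\mathrm{id}$, $\varphi_{t+s}=\varphi_t\circ\varphi_s$ for all $s,t\ge0$, and $\varphi_t\to\mathrm{id}$ uniformly on compacta as $t\to0^+$. A linear fractional self-map of $\mathbb{D}$ is a non-constant map of the form $z\mapsto\frac{az+b}{cz+d}$, with $|d|>|c|$, mapping $\mathbb{D}$ into $\mathbb{D}$. *)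

(* Defs.v *)
From Stdlib Require Import Reals List.
From Coquelicot Require Import Coquelicot.

Open Scope R_scope.

Definition unit_disc (z : C) : Prop := Cmod z < 1.

(* Maps of the disc are total functions C -> C of which only the restriction
   to the disc is ever constrained. *)
Definition maps_disc_into_disc (f : C -> C) : Prop :=
  forall z : C, unit_disc z -> unit_disc (f z).

Definition holomorphic_on_disc (f : C -> C) : Prop :=
  forall z : C, unit_disc z -> @ex_derive C_AbsRing C_NormedModule f z.

(* Stdlib's compact only concerns subsets of R. *)
Definition compact_set {T : UniformSpace} (K : T -> Prop) : Prop :=
  forall (I : Type) (U : I -> T -> Prop),
    (forall i : I, open (U i)) ->
    (forall x : T, K x -> exists i : I, U i x) ->
    exists l : list I, forall x : T, K x -> exists i : I, In i l /\ U i x.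

(* The values of phi at negative times are irrelevant. *)
Record continuous_semigroup (phi : R -> C -> C) : Prop := {
  semigroup_self_map : forall t : R, 0 <= t -> maps_disc_into_disc (phi t);
  semigroup_holomorphic : forall t : R, 0 <= t -> holomorphic_on_disc (phi t);
  semigroup_zero : forall z : C, unit_disc z -> phi 0 z = z;
  semigroup_add : forall s t : R, 0 <= s -> 0 <= t ->
    forall z : C, unit_disc z -> phi (t + s) z = phi t (phi s z);
  semigroup_continuous : forall K : C -> Prop,
    compact_set K -> (forall z : C, K z -> unit_disc z) ->
    forall eps : R, 0 < eps ->
      at_right 0 (fun t : R => forall z : C, K z -> Cmod (phi t z - z)%C < eps)
}.

(* The condition |c| < |d| makes c z + d nonzero on the disc, so the totalised
   division of C plays no role. *)
Definition linear_fractional_self_map (f : C -> C) : Prop :=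
  (exists a b c d : C, Cmod d > Cmod c /\
     forall z : C, unit_disc z -> f z = ((a * z + b) / (c * z + d))%C) /\
  (exists z w : C, unit_disc z /\ unit_disc w /\ f z <> f w) /\
  maps_disc_into_disc f.

(* Main.v *)
Require Import Defs.
From Stdlib Require Import Reals Lra Psatz.
From Coquelicot Require Import Coquelicot.

Open Scope R_scope.

(** Given [t >= 0], choose [n] with [t <= n t0] and put [f = phi_t],
    [g = phi_(n t0 - t)], [m = phi_(n t0)].  Then [f o g = g o f = m], and [m] is
    an injective Moebius map, being an iterate of [phi_t0].  So everything reduces
    to a statement about two commuting holomorphic self-maps of the disc: if their
    composite is an injective Moebius map, they are Moebius ([mobius_root]).

    The geometric reason: on the increasing union [Omega] of the discs
    [m^(-n)(D)], which is a disc or a sphere minus a point, [m] is bijective.  As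
    [f] commutes with [m], it extends to [Omega], and the extension has the
    inverse [m^(-1) o g].  Bijective holomorphic maps of a disc or a plane are
    Moebius.  The proof does not construct [Omega]; it works with pseudo-hyperbolic
    distances in [D] along the orbits of [m].

    After conjugation by a disc automorphism, [m] fixes the origin or the boundary
    point [1].  To see this, take a root [p] of the fixed point equation.  If [p]
    lies outside the closed disc, a conjugation sends it to infinity, [m] becomes
    affine, and an affine self-map of the disc visibly has a fixed point in the
    closed disc ([mobius_root_affine]).

    - If the origin is fixed and attracting, a coordinate [U] makes [m]
      multiplication by [mu], [|mu| < 1].  Since [f] commutes with [m], the ratio
      [U(f z) / U z] is constant along the orbit of [z], which tends to [0], so it
      equals the derivative of [f] at [0] and [f] is linear in the coordinate [U]
      ([mobius_attracting]).
    - If [m] is a rotation, it preserves hyperbolic distances, and the Schwarz-Pick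
      inequalities for [f] and [g] show that [f] does so too.
    - If [m] has no fixed point in the open disc, the Schwarz-Pick inequalities for
      [f] on [m^n(D)] and for [g] on [f(m^n(D))] compare the distance of [f z] and
      [f w] with that of [z] and [w], for the metrics of [m^(-n)(D)] and
      [m^(-n-1)(D)] ([interlaced]).  In the limit [f] is an isometry for the
      hyperbolic or Euclidean metric of [Omega].

    In the last two cases the case of equality in Schwarz-Pick makes [f] Moebius
    ([mobius_rigidity]).

    The Schwarz-Pick inequality is proved from the definition of complex
    differentiability: Goursat's theorem on rectangles, applied to [k o exp], bounds
    [|k 0|] by the values of [k] on the unit circle; precomposing with disc
    automorphisms gives the maximum principle, hence the Schwarz lemma. *)

(** * Complex differentiability *)

(** Continuity for the metric given by [Cmod].  The source and target are the
    absolute ring [C], so that the rules for products of ring-valued functions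
    apply; the product uniform structure on [C] is a different term. *)
Definition ccont (f : C -> C) (z : C) : Prop :=
  @continuous (AbsRing_UniformSpace C_AbsRing) (AbsRing_UniformSpace C_AbsRing) f z.

(** The target is [C] as a module over itself with the topology of [Cmod], for
    the same reason; the chain and product rules then come for free. *)
Definition cdiff (f : C -> C) (z : C) : Prop :=
  @ex_derive C_AbsRing (AbsRing_NormedModule C_AbsRing) f z.

Lemma ccontP (f : C -> C) (z : C) :
  ccont f z <-> forall eps, 0 < eps -> exists delta, 0 < delta /\
    forall w, Cmod (w - z) < delta -> Cmod (f w - f z) < eps.
Proof.
unfold ccont; split.
- intros H eps He.
  destruct (proj1 (filterlim_locally _ _) H (mkposreal eps He)) as [d Hd].
  exists d; split; [apply cond_pos|]. intros w Hw. exact (Hd w Hw).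
- intros H. apply filterlim_locally. intros eps.
  destruct (H eps (cond_pos eps)) as [d [Hd H']].
  exists (mkposreal d Hd). intros w Hw. exact (H' w Hw).
Qed.

Lemma locally_C (P : C -> Prop) (z : C) :
  @locally (AbsRing_UniformSpace C_AbsRing) z P <->
  exists delta, 0 < delta /\ forall w, Cmod (w - z) < delta -> P w.
Proof.
split.
- intros [d Hd]. exists d. split; [apply cond_pos|]. exact Hd.
- intros [d [Hd H]]. exists (mkposreal d Hd). exact H.
Qed.

Lemma cdiffP (f : C -> C) (z : C) :
  cdiff f z <-> exists l, forall eps, 0 < eps -> exists delta, 0 < delta /\
    forall w, Cmod (w - z) < delta ->
      Cmod (f w - f z - l * (w - z))%C <= eps * Cmod (w - z).
Proof.
unfold cdiff; split.
- intros [l [_ H]]. exists l. intros eps He.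
  specialize (H z (fun P HP => HP) (mkposreal eps He)).
  apply locally_C in H. destruct H as [d [Hd H]].
  exists d. split; trivial. intros w Hw. specialize (H w Hw).
  replace (l * (w - z))%C with ((w - z) * l)%C by ring. exact H.
- intros [l H]. exists l. split; [apply is_linear_scal_l|].
  intros x Hx.
  apply (@is_filter_lim_locally_unique C_AbsRing (AbsRing_NormedModule C_AbsRing)) in Hx.
  rewrite <- Hx. intros eps.
  destruct (H eps (cond_pos eps)) as [d [Hd H']].
  apply locally_C. exists d; split; trivial. intros w Hw. specialize (H' w Hw).
  replace (l * (w - z))%C with ((w - z) * l)%C in H' by ring. exact H'.
Qed.

(** The two module structures on [C] have the same norm, and differentiability
    only speaks about the norm of the target. *)
Lemma cdiff_of_ex_derive (f : C -> C) (z : C) :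
  @ex_derive C_AbsRing C_NormedModule f z -> cdiff f z.
Proof.
intros [l [_ H]]. apply cdiffP. exists l. intros eps He.
  specialize (H z (fun P HP => HP) (mkposreal eps He)).
  apply locally_C in H. destruct H as [d [Hd H]].
  exists d. split; trivial. intros w Hw. specialize (H w Hw).
  replace (l * (w - z))%C with ((w - z) * l)%C by ring. exact H.
Qed.

Lemma cdiff_cont (f : C -> C) (z : C) : cdiff f z -> ccont f z.
Proof. apply (@ex_derive_continuous C_AbsRing (AbsRing_NormedModule C_AbsRing)). Qed.

Lemma cdiff_const (k z : C) : cdiff (fun _ => k) z.
Proof. apply (@ex_derive_const C_AbsRing (AbsRing_NormedModule C_AbsRing)). Qed.

Lemma cdiff_id (z : C) : cdiff (fun w => w) z.
Proof. apply (@ex_derive_id C_AbsRing). Qed.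

Lemma cdiff_plus (f g : C -> C) (z : C) : cdiff f z -> cdiff g z -> cdiff (fun w => f w + g w)%C z.
Proof. apply (@ex_derive_plus C_AbsRing (AbsRing_NormedModule C_AbsRing)). Qed.

Lemma cdiff_minus (f g : C -> C) (z : C) : cdiff f z -> cdiff g z -> cdiff (fun w => f w - g w)%C z.
Proof. apply (@ex_derive_minus C_AbsRing (AbsRing_NormedModule C_AbsRing)). Qed.

Lemma cdiff_mult (f g : C -> C) (z : C) : cdiff f z -> cdiff g z -> cdiff (fun w => f w * g w)%C z.
Proof.
intros [l Hl] [m Hm]. eexists. apply (@is_derive_mult C_AbsRing f g z l m Hl Hm).
intros a b. apply Cmult_comm.
Qed.

Lemma cdiff_comp (f g : C -> C) (z : C) : cdiff f (g z) -> cdiff g z -> cdiff (fun w => f (g w)) z.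
Proof. apply (@ex_derive_comp C_AbsRing (AbsRing_NormedModule C_AbsRing)). Qed.

Lemma cdiff_local (f g : C -> C) (z : C) (d : R) : 0 < d ->
  (forall w, Cmod (w - z) < d -> f w = g w) -> cdiff f z -> cdiff g z.
Proof.
intros Hd H. apply (@ex_derive_ext_loc C_AbsRing (AbsRing_NormedModule C_AbsRing)).
apply locally_C. exists d. split; trivial.
Qed.

Lemma ccont_const (k z : C) : ccont (fun _ => k) z.
Proof. apply cdiff_cont, cdiff_const. Qed.

Lemma ccont_id (z : C) : ccont (fun w => w) z.
Proof. apply cdiff_cont, cdiff_id. Qed.

Lemma ccont_minus (f g : C -> C) (z : C) : ccont f z -> ccont g z -> ccont (fun w => f w - g w)%C z.
Proof. apply (@continuous_minus (AbsRing_UniformSpace C_AbsRing) C_AbsRing (AbsRing_NormedModule C_AbsRing)). Qed.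

Lemma ccont_mult (f g : C -> C) (z : C) : ccont f z -> ccont g z -> ccont (fun w => f w * g w)%C z.
Proof. apply (@continuous_mult (AbsRing_UniformSpace C_AbsRing) C_AbsRing). Qed.

Lemma ccont_comp (f g : C -> C) (z : C) : ccont f (g z) -> ccont g z -> ccont (fun w => f (g w)) z.
Proof.
intros H1 H2. set (U := AbsRing_UniformSpace C_AbsRing).
exact (@continuous_comp U U U g f z H2 H1). Qed.

Lemma Cmod_sub_ge (a b : C) : Cmod a - Cmod b <= Cmod (a - b).
Proof.
assert (H := Cmod_triangle (a - b) b).
replace (a - b + b)%C with a in H by ring. lra.
Qed.

Lemma Cmod_sub_sym (a b : C) : Cmod (a - b) = Cmod (b - a).
Proof. rewrite <- Cmod_opp. f_equal. ring. Qed.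

Lemma cdiff_inv_id (z : C) : z <> 0%C -> cdiff (fun w => / w)%C z.
Proof.
intros Hz. assert (Hm := proj1 (Cmod_gt_0 z) Hz).
apply cdiffP. exists (- / (z * z))%C. intros eps He.
set (m := Cmod z) in *.
exists (Rmin (m / 2) (eps * (m * m * m) / 2)).
assert (Hmm : 0 < m * m * m) by (repeat apply Rmult_lt_0_compat; lra).
split. { apply Rmin_pos; [lra|]. assert (0 < eps * (m * m * m)) by (apply Rmult_lt_0_compat; lra). lra. }
intros w Hw.
assert (H1 := Rmin_l (m / 2) (eps * (m * m * m) / 2)).
assert (H2 := Rmin_r (m / 2) (eps * (m * m * m) / 2)).
assert (Hwm : m / 2 < Cmod w).
{ assert (H := Cmod_sub_ge z w). rewrite Cmod_sub_sym in H. fold m in H. lra. }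
assert (Hw0 : w <> 0%C) by (apply Cmod_gt_0; lra).
replace (/ w - / z - - / (z * z) * (w - z))%C with ((w - z) * (w - z) / (z * z * w))%C
  by (field; auto).
rewrite Cmod_div by (repeat apply Cmult_neq_0; auto).
rewrite !Cmod_mult. fold m.
apply Rle_div_l. { repeat apply Rmult_lt_0_compat; lra. }
replace (eps * Cmod (w - z) * (m * m * Cmod w)) with (Cmod (w-z) * (eps * (m * m * Cmod w))) by ring.
apply Rmult_le_compat_l; [apply Cmod_ge_0|].
apply Rle_trans with (eps * (m * m * (m / 2))); [lra|].
apply Rmult_le_compat_l; [lra|]. apply Rmult_le_compat_l; [nra|]. lra.
Qed.

Lemma cdiff_div (f g : C -> C) (z : C) : g z <> 0%C -> cdiff f z -> cdiff g z ->
  cdiff (fun w => f w / g w)%C z.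
Proof.
intros H Hf Hg. apply cdiff_mult; trivial. apply (cdiff_comp (fun w => / w)%C g); trivial.
now apply cdiff_inv_id.
Qed.

Lemma ccont_div (f g : C -> C) (z : C) : g z <> 0%C -> ccont f z -> ccont g z ->
  ccont (fun w => f w / g w)%C z.
Proof.
intros H Hf Hg. apply ccont_mult; trivial. apply (ccont_comp (fun w => / w)%C g); trivial.
apply cdiff_cont. now apply cdiff_inv_id.
Qed.

Lemma cdiff_pow (f : C -> C) (z : C) n : cdiff f z -> cdiff (fun w => f w ^ n)%C z.
Proof. intros H. induction n; simpl. apply cdiff_const. now apply cdiff_mult. Qed.

Lemma ccont_pow (f : C -> C) (z : C) n : ccont f z -> ccont (fun w => f w ^ n)%C z.
Proof. intros H. induction n; simpl. apply ccont_const. now apply ccont_mult. Qed.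

(** Caratheodory's form of differentiability.  The slope [h] is total, so the
    identity holds at every [w] and can be rewritten without side conditions. *)
Lemma cdiff_slope (f : C -> C) (z : C) : cdiff f z ->
  exists h, ccont h z /\ forall w, (f w - f z = h w * (w - z))%C.
Proof.
intros H. apply cdiffP in H. destruct H as [l H].
exists (fun w => if Ceq_dec w z then l else (f w - f z) / (w - z))%C.
split.
- apply ccontP. intros eps He. destruct (H (eps / 2)) as [d [Hd H']]; [lra|].
  exists d. split; trivial. intros w Hw.
  destruct (Ceq_dec z z) as [_|n]; [|now destruct n].
  destruct (Ceq_dec w z) as [->|n].
  + replace (l - l)%C with (RtoC 0) by ring. now rewrite Cmod_0.
  + assert (Hn : (w - z <> 0)%C) by (intros E; apply n; replace w with (w - z + z)%C by ring; rewrite E; ring).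
    replace ((f w - f z) / (w - z) - l)%C with ((f w - f z - l * (w - z)) / (w - z))%C by (field; trivial).
    rewrite Cmod_div by trivial.
    assert (Hp := proj1 (Cmod_gt_0 _) Hn).
    apply Rle_lt_trans with (eps / 2); [|lra].
    apply Rle_div_l; [lra|]. now apply H'.
- intros w. destruct (Ceq_dec w z) as [->|n]; [ring|].
  field. intros E; apply n; replace w with (w - z + z)%C by ring; rewrite E; ring.
Qed.

Lemma slope_cdiff (f h : C -> C) (z : C) : ccont h z -> (forall w, f w - f z = h w * (w - z))%C -> cdiff f z.
Proof.
intros Hc Hs. apply cdiffP. exists (h z). intros eps He.
destruct (proj1 (ccontP h z) Hc eps He) as [d [Hd H]].
exists d. split; trivial. intros w Hw. rewrite Hs.
replace (h w * (w - z) - h z * (w - z))%C with ((h w - h z) * (w - z))%C by ring.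
rewrite Cmod_mult. apply Rmult_le_compat_r; [apply Cmod_ge_0|]. now apply Rlt_le, H.
Qed.

(** * Goursat's theorem for rectangles *)

Definition CRInt (p : R -> C) (a b : R) : C := @RInt C_R_CompleteNormedModule p a b.

Definition rcont (p : R -> C) (t : R) : Prop :=
  forall eps, 0 < eps -> exists delta, 0 < delta /\
    forall u, Rabs (u - t) < delta -> Cmod (p u - p t) < eps.

Lemma rcont_continuous (p : R -> C) (t : R) :
  rcont p t -> @continuous R_UniformSpace C_R_CompleteNormedModule p t.
Proof.
intros H. apply filterlim_locally. intros eps.
destruct (H eps (cond_pos eps)) as [d [Hd H']].
exists (mkposreal d Hd). intros u Hu. specialize (H' u Hu).
assert (Hm := Rmax_Cmod (p u - p t)%C).
assert (H1 := Rmax_l (Rabs (fst (p u - p t)%C)) (Rabs (snd (p u - p t)%C))).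
assert (H2 := Rmax_r (Rabs (fst (p u - p t)%C)) (Rabs (snd (p u - p t)%C))).
split.
- change (Rabs (fst (p u) - fst (p t)) < eps). exact (Rle_lt_trans _ _ _ H1 (Rle_lt_trans _ _ _ Hm H')).
- change (Rabs (snd (p u) - snd (p t)) < eps). exact (Rle_lt_trans _ _ _ H2 (Rle_lt_trans _ _ _ Hm H')).
Qed.

Lemma rcont_minus (p q : R -> C) t : rcont p t -> rcont q t -> rcont (fun u => p u - q u)%C t.
Proof.
intros Hp Hq eps He.
destruct (Hp (eps / 2)) as [d1 [Hd1 H1]]; [lra|].
destruct (Hq (eps / 2)) as [d2 [Hd2 H2]]; [lra|].
exists (Rmin d1 d2). split; [now apply Rmin_pos|]. intros u Hu.
assert (Rmin d1 d2 <= d1) by apply Rmin_l. assert (Rmin d1 d2 <= d2) by apply Rmin_r.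
specialize (H1 u ltac:(lra)). specialize (H2 u ltac:(lra)).
replace (p u - q u - (p t - q t))%C with ((p u - p t) + - (q u - q t))%C by ring.
assert (H3 := Cmod_triangle (p u - p t) (- (q u - q t))). rewrite Cmod_opp in H3. lra.
Qed.

Lemma ccont_path (F : C -> C) (p : R -> C) t : ccont F (p t) ->
  (forall u, Cmod (p u - p t) = Rabs (u - t)) -> rcont (fun u => F (p u)) t.
Proof.
intros H Hp eps He. destruct (proj1 (ccontP _ _) H eps He) as [d [Hd H']].
exists d. split; trivial. intros u Hu. apply H'. now rewrite Hp.
Qed.

Lemma Cmod_hor (u t c : R) : Cmod ((u, c) - (t, c))%C = Rabs (u - t).
Proof.
replace ((u, c) - (t, c))%C with (RtoC (u - t)) by (apply injective_projections; simpl; ring).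
apply Cmod_R.
Qed.

Lemma Cmod_ver (u t c : R) : Cmod ((c, u) - (c, t))%C = Rabs (u - t).
Proof.
replace ((c, u) - (c, t))%C with (Ci * RtoC (u - t))%C by (apply injective_projections; simpl; ring).
rewrite Cmod_mult, Cmod_R, Cmod_Ci. ring.
Qed.

Lemma ex_CRInt (p : R -> C) a b : a <= b -> (forall t, a <= t <= b -> rcont p t) ->
  @ex_RInt C_R_CompleteNormedModule p a b.
Proof.
intros Hab H. apply ex_RInt_continuous. intros z. rewrite Rmin_left, Rmax_right by trivial.
intros Hz. now apply rcont_continuous, H.
Qed.

Lemma CRInt_approx (p : R -> C) (k : C) a b M : a <= b ->
  (forall t, a <= t <= b -> rcont p t) ->
  (forall t, a <= t <= b -> Cmod (p t - k) <= M) ->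
  Cmod (CRInt p a b - RtoC (b - a) * k) <= (b - a) * M.
Proof.
intros Hab Hc HM.
assert (Hi := ex_CRInt p a b Hab Hc).
assert (H := RInt_correct _ _ _ Hi).
assert (H2 := is_RInt_minus _ _ _ _ _ _ H (@is_RInt_const C_R_CompleteNormedModule a b k)).
assert (H3 := norm_RInt_le_const _ a b _ M Hab (fun t Ht => eq_ind _ (fun r => r <= M) (HM t Ht) _ (Cmod_norm _)) H2).
rewrite <- Cmod_norm in H3.
replace (CRInt p a b - (b - a)%R * k)%C with (minus (CRInt p a b) (@scal R_AbsRing C_R_ModuleSpace (b - a) k)).
exact H3.
apply injective_projections; simpl; unfold minus, plus, opp, scal; simpl; unfold mult; simpl; ring.
Qed.

(** The integral of [F] around the boundary of [[a, b] x [c, d]], with opposite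
    sides grouped: for affine [F] both integrands are constant. *)
Definition rect_int (F : C -> C) (a b c d : R) : C :=
  (CRInt (fun x => F (x, c) - F (x, d))%C a b
   + Ci * CRInt (fun y => F (b, y) - F (a, y))%C c d)%C.

Definition cont_on_rect (F : C -> C) a b c d :=
  forall x y, a <= x <= b -> c <= y <= d -> ccont F (x, y).

Lemma rcont_hor F a b c d x y : cont_on_rect F a b c d -> a <= x <= b -> c <= y <= d ->
  rcont (fun t => F (t, y)) x.
Proof.
intros H Hx Hy. apply (ccont_path F (fun t => (t, y))). now apply H. intros u. apply Cmod_hor.
Qed.

Lemma rcont_ver F a b c d x y : cont_on_rect F a b c d -> a <= x <= b -> c <= y <= d ->
  rcont (fun t => F (x, t)) y.
Proof.
intros H Hx Hy. apply (ccont_path F (fun t => (x, t))). now apply H. intros u. apply Cmod_ver.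
Qed.

Lemma CRInt_Chasles p a b c : a <= b -> b <= c -> (forall t, a <= t <= c -> rcont p t) ->
  CRInt p a c = (CRInt p a b + CRInt p b c)%C.
Proof.
intros H1 H2 H. symmetry. apply (@RInt_Chasles C_R_CompleteNormedModule p a b c);
  apply ex_CRInt; trivial; intros t Ht; apply H; lra.
Qed.

(** Integrals over the common side of two adjacent rectangles cancel. *)
Lemma CRInt_telescope p q r a b : a <= b -> (forall t, a <= t <= b -> rcont p t) ->
  (forall t, a <= t <= b -> rcont q t) -> (forall t, a <= t <= b -> rcont r t) ->
  CRInt (fun t => p t - r t)%C a b
   = (CRInt (fun t => p t - q t)%C a b + CRInt (fun t => q t - r t)%C a b)%C.
Proof.
intros Hab Hp Hq Hr.
assert (H := @RInt_plus C_R_CompleteNormedModule (fun t => p t - q t)%C (fun t => q t - r t)%C a b).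
etransitivity; [|apply H]; try (apply ex_CRInt; trivial; intros; apply rcont_minus; auto).
apply (@RInt_ext C_R_CompleteNormedModule). intros t _. change (p t - r t = (p t - q t) + (q t - r t))%C. ring.
Qed.

Lemma rect_int_split_x F a e b c d : a <= e -> e <= b -> c <= d ->
  cont_on_rect F a b c d -> rect_int F a b c d = (rect_int F a e c d + rect_int F e b c d)%C.
Proof.
intros H1 H2 H3 H. unfold rect_int.
rewrite (CRInt_Chasles _ a e b); trivial.
rewrite (CRInt_telescope (fun y => F (b, y)) (fun y => F (e, y)) (fun y => F (a, y)) c d); trivial.
ring.
all: intros t Ht; try apply rcont_minus; try (eapply rcont_ver; [exact H|lra|lra]);
  (eapply rcont_hor; [exact H|lra|lra]).
Qed.

Lemma rect_int_split_y F a b c e d : a <= b -> c <= e -> e <= d ->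
  cont_on_rect F a b c d -> rect_int F a b c d = (rect_int F a b c e + rect_int F a b e d)%C.
Proof.
intros H1 H2 H3 H. unfold rect_int.
rewrite (CRInt_Chasles _ c e d); trivial.
rewrite (CRInt_telescope (fun x => F (x, c)) (fun x => F (x, e)) (fun x => F (x, d)) a b); trivial.
ring.
all: intros t Ht; try apply rcont_minus; try (eapply rcont_hor; [exact H|lra|lra]);
  (eapply rcont_ver; [exact H|lra|lra]).
Qed.

Lemma Cmod_rect_diam a b c d x y x0 y0 :
  a <= x <= b -> a <= x0 <= b -> c <= y <= d -> c <= y0 <= d ->
  Cmod ((x, y) - (x0, y0)) <= (b - a) + (d - c).
Proof.
intros. replace ((x, y) - (x0, y0))%C with (((x, y) - (x0, y)) + ((x0, y) - (x0, y0)))%C by ring.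
eapply Rle_trans; [apply Cmod_triangle|]. rewrite Cmod_hor, Cmod_ver.
apply Rplus_le_compat; apply Rabs_le; lra.
Qed.

(** The boundary integral of an affine function vanishes, so only the error of the
    affine approximation contributes.  A bound proportional to the area, with a
    factor that can be made small, is what the bisection needs. *)
Lemma rect_int_almost_affine F a b c d x0 y0 (k l : C) eps : a <= b -> c <= d ->
  a <= x0 <= b -> c <= y0 <= d -> 0 <= eps -> cont_on_rect F a b c d ->
  (forall x y, a <= x <= b -> c <= y <= d ->
     Cmod (F (x, y) - k - l * ((x, y) - (x0, y0))) <= eps * Cmod ((x, y) - (x0, y0))) ->
  Cmod (rect_int F a b c d) <= 2 * eps * ((b - a) + (d - c)) ^ 2.
Proof.
intros Hab Hcd Hx0 Hy0 He Hc H.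
set (D := (b - a) + (d - c)).
assert (HD : forall x y, a <= x <= b -> c <= y <= d ->
     Cmod (F (x, y) - k - l * ((x, y) - (x0, y0))) <= eps * D).
{ intros x y Hx Hy. eapply Rle_trans; [now apply H|]. apply Rmult_le_compat_l; trivial.
  apply Cmod_rect_diam; trivial. }
assert (Hd2 : forall x y x' y', a <= x <= b -> c <= y <= d -> a <= x' <= b -> c <= y' <= d ->
   Cmod (F (x, y) - F (x', y') - l * ((x, y) - (x', y'))) <= 2 * eps * D).
{ intros x y x' y' Hx Hy Hx' Hy'.
  assert (H1 := HD x y Hx Hy). assert (H2 := HD x' y' Hx' Hy').
  replace (F (x, y) - F (x', y') - l * ((x, y) - (x', y')))%C with
   ((F (x, y) - k - l * ((x, y) - (x0, y0))) + - (F (x', y') - k - l * ((x', y') - (x0, y0))))%C by ring.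
  eapply Rle_trans; [apply Cmod_triangle|]. rewrite Cmod_opp. lra. }
assert (HX : Cmod (CRInt (fun x => F (x, c) - F (x, d))%C a b - RtoC (b - a) * (l * (0, c - d)%R))
   <= (b - a) * (2 * eps * D)).
{ apply CRInt_approx; trivial.
  - intros t Ht. apply rcont_minus; eapply rcont_hor; try exact Hc; lra.
  - intros t Ht. replace (0, c - d)%R with ((t, c) - (t, d))%C by (apply injective_projections; simpl; ring).
    apply Hd2; lra. }
assert (HY : Cmod (CRInt (fun y => F (b, y) - F (a, y))%C c d - RtoC (d - c) * (l * (b - a, 0)%R))
   <= (d - c) * (2 * eps * D)).
{ apply CRInt_approx; trivial.
  - intros t Ht. apply rcont_minus; eapply rcont_ver; try exact Hc; lra.
  - intros t Ht. replace (b - a, 0)%R with ((b, t) - (a, t))%C by (apply injective_projections; simpl; ring).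
    apply Hd2; lra. }
unfold rect_int.
set (X := CRInt _ a b) in *. set (Y := CRInt _ c d) in *.
replace (X + Ci * Y)%C with
  ((X - RtoC (b - a) * (l * (0, c - d)%R)) + Ci * (Y - RtoC (d - c) * (l * (b - a, 0)%R)))%C.
2:{ apply injective_projections; simpl; ring. }
eapply Rle_trans; [apply Cmod_triangle|]. rewrite Cmod_mult, Cmod_Ci.
unfold D in *. nra.
Qed.

Lemma nested_intervals (u v : nat -> R) : (forall n, u n <= u (S n)) ->
  (forall n, v (S n) <= v n) -> (forall n, u n <= v n) -> exists x, forall n, u n <= x <= v n.
Proof.
intros Hu Hv Huv.
assert (Mu : forall n k, u n <= u (n + k)%nat).
{ intros n k. induction k. rewrite Nat.add_0_r. lra. rewrite Nat.add_succ_r. specialize (Hu (n + k)%nat). lra. }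
assert (Mv : forall n k, v (n + k)%nat <= v n).
{ intros n k. induction k. rewrite Nat.add_0_r. lra. rewrite Nat.add_succ_r. specialize (Hv (n + k)%nat). lra. }
assert (Mm : forall n m, u n <= v m).
{ intros n m. specialize (Mu n m). specialize (Mv m n). specialize (Huv (n + m)%nat).
  rewrite Nat.add_comm in Mv. lra. }
destruct (completeness (fun r => exists n, r = u n)) as [x [H1 H2]].
- exists (v 0%nat). intros r [n ->]. apply Mm.
- exists (u 0%nat). now exists 0%nat.
- exists x. intros n. split. apply H1. now exists n. apply H2. intros r [m ->]. apply Mm.
Qed.

Definition rect_at (F : C -> C) (w h : R) (q : C) : C :=
  rect_int F (fst q) (fst q + w) (snd q) (snd q + h).

(** The lower left corner of one of the four quarters, of size [w] by [h], of the
    rectangle with corner [q]: the first one whose integral is at least [k], the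
    last one by default.  Comparing real numbers makes the choice a function. *)
Definition quarter (F : C -> C) (k w h : R) (q : C) : C :=
  if Rle_dec k (Cmod (rect_at F w h q)) then q
  else if Rle_dec k (Cmod (rect_at F w h (fst q + w, snd q))) then (fst q + w, snd q)
  else if Rle_dec k (Cmod (rect_at F w h (fst q, snd q + h))) then (fst q, snd q + h)
  else (fst q + w, snd q + h).

Lemma quarter_in F k w h q : 0 <= w -> 0 <= h ->
  fst q <= fst (quarter F k w h q) <= fst q + w /\
  snd q <= snd (quarter F k w h q) <= snd q + h.
Proof.
intros Hw Hh. unfold quarter.
do 3 (case Rle_dec; intros _; [cbn [fst snd]; lra|]). cbn [fst snd]; lra.
Qed.

(** The four integrals add up to that of the big rectangle, so they cannot all be
    smaller than a quarter of it. *)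
Lemma quarter_large F k w h q : 0 <= w -> 0 <= h ->
  cont_on_rect F (fst q) (fst q + 2 * w) (snd q) (snd q + 2 * h) ->
  4 * k <= Cmod (rect_at F (2 * w) (2 * h) q) ->
  k <= Cmod (rect_at F w h (quarter F k w h q)).
Proof.
intros Hw Hh Hc H. unfold quarter.
case Rle_dec; intros N1; trivial. case Rle_dec; intros N2; trivial. case Rle_dec; intros N3; trivial.
destruct q as [x y]. unfold rect_at in *. cbn [fst snd] in *.
replace (x + 2 * w) with (x + w + w) in * by ring.
replace (y + 2 * h) with (y + h + h) in * by ring.
assert (Hc' : forall a b c d, x <= a -> b <= x + w + w -> y <= c -> d <= y + h + h ->
  cont_on_rect F a b c d).
{ intros a b c d ? ? ? ? s t ? ?. apply Hc; lra. }
rewrite (rect_int_split_x F x (x + w)) in H by first [lra | apply Hc'; lra].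
rewrite (rect_int_split_y F x (x + w) y (y + h)) in H by first [lra | apply Hc'; lra].
rewrite (rect_int_split_y F (x + w) (x + w + w) y (y + h)) in H by first [lra | apply Hc'; lra].
match goal with |- _ <= Cmod ?d => set (D := d) in * end.
match type of H with _ <= Cmod ((?a + ?b) + (?c + _)) =>
  assert (T := Cmod_triangle (a + b) (c + D)); assert (T1 := Cmod_triangle a b);
  assert (T2 := Cmod_triangle c D) end.
lra.
Qed.

Fixpoint corner (F : C -> C) (K W H : R) (p : C) (n : nat) : C :=
  match n with
  | O => p
  | S m => quarter F (K / 4 ^ S m) (W / 2 ^ S m) (H / 2 ^ S m) (corner F K W H p m)
  end.

Lemma half_pow (x : R) n : x / 2 ^ n = 2 * (x / 2 ^ S n).
Proof. simpl. field. apply pow_nonzero. lra. Qed.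

Lemma quarter_pow (x : R) n : x / 4 ^ n = 4 * (x / 4 ^ S n).
Proof. simpl. field. apply pow_nonzero. lra. Qed.

Lemma div_pow_pos (x b : R) n : 0 < x -> 0 < b -> 0 < x / b ^ n.
Proof. intros. apply Rdiv_lt_0_compat; trivial. now apply pow_lt. Qed.

Lemma corner_step F K W H p n : 0 < W -> 0 < H ->
  (fst (corner F K W H p n) <= fst (corner F K W H p (S n)) /\
   fst (corner F K W H p (S n)) + W / 2 ^ S n <= fst (corner F K W H p n) + W / 2 ^ n) /\
  (snd (corner F K W H p n) <= snd (corner F K W H p (S n)) /\
   snd (corner F K W H p (S n)) + H / 2 ^ S n <= snd (corner F K W H p n) + H / 2 ^ n).
Proof.
intros HW HH. cbn [corner].
assert (W1 := div_pow_pos W 2 (S n) HW ltac:(lra)).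
assert (H1 := div_pow_pos H 2 (S n) HH ltac:(lra)).
rewrite (half_pow W n), (half_pow H n).
destruct (quarter_in F (K / 4 ^ S n) (W / 2 ^ S n) (H / 2 ^ S n) (corner F K W H p n)); lra.
Qed.

Lemma corner_in F K W H p n : 0 < W -> 0 < H ->
  (fst p <= fst (corner F K W H p n) /\ fst (corner F K W H p n) + W / 2 ^ n <= fst p + W) /\
  (snd p <= snd (corner F K W H p n) /\ snd (corner F K W H p n) + H / 2 ^ n <= snd p + H).
Proof.
intros HW HH. induction n as [|n IH]. simpl. lra.
destruct (corner_step F K W H p n HW HH). lra.
Qed.

Lemma corner_large F K W H p n : 0 < W -> 0 < H ->
  cont_on_rect F (fst p) (fst p + W) (snd p) (snd p + H) ->
  K <= Cmod (rect_at F W H p) ->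
  K / 4 ^ n <= Cmod (rect_at F (W / 2 ^ n) (H / 2 ^ n) (corner F K W H p n)).
Proof.
intros HW HH Hc Hp. induction n as [|n IH]. { simpl. now rewrite !Rdiv_1_r. }
destruct (corner_in F K W H p n HW HH) as [Hx Hy].
rewrite (half_pow W n), (half_pow H n), quarter_pow in IH.
rewrite (half_pow W n) in Hx. rewrite (half_pow H n) in Hy.
assert (W1 := div_pow_pos W 2 (S n) HW ltac:(lra)).
assert (H1 := div_pow_pos H 2 (S n) HH ltac:(lra)).
cbn [corner]. apply quarter_large; trivial; try lra.
intros s t Hs Ht. apply Hc; lra.
Qed.

(** If the integral has modulus [K > 0], repeated bisection yields nested
    rectangles on which it is at least [K / 4 ^ n].  At their common point [F] is
    differentiable, so the integral is at most a small multiple of the area, which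
    is also of order [1 / 4 ^ n]. *)
Lemma goursat F a b c d : a < b -> c < d ->
  (forall x y, a <= x <= b -> c <= y <= d -> cdiff F (x, y)) -> rect_int F a b c d = RtoC 0.
Proof.
intros Hab Hcd Fdiff. apply Cmod_eq_0.
destruct (Rle_lt_or_eq_dec 0 _ (Cmod_ge_0 (rect_int F a b c d))) as [HK|<-]; trivial.
exfalso.
set (K := Cmod (rect_int F a b c d)) in *.
set (W := b - a). set (H := d - c).
assert (HW : 0 < W) by (unfold W; lra). assert (HH : 0 < H) by (unfold H; lra).
set (q := corner F K W H (a, c)).
assert (Hin := fun n => corner_in F K W H (a, c) n HW HH). fold q in Hin. cbn [fst snd] in Hin.
replace (a + W) with b in Hin by (unfold W; ring). replace (c + H) with d in Hin by (unfold H; ring).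
assert (Hstep := fun n => corner_step F K W H (a, c) n HW HH). fold q in Hstep.
assert (HWn := fun n => div_pow_pos W 2 n HW Rlt_0_2).
assert (HHn := fun n => div_pow_pos H 2 n HH Rlt_0_2).
destruct (nested_intervals (fun n => fst (q n)) (fun n => fst (q n) + W / 2 ^ n)) as [x Hx].
1,2,3: intros n; specialize (HWn n); destruct (Hstep n); lra.
destruct (nested_intervals (fun n => snd (q n)) (fun n => snd (q n) + H / 2 ^ n)) as [y Hy].
1,2,3: intros n; specialize (HHn n); destruct (Hstep n); lra.
assert (Hd : cdiff F (x, y)).
{ specialize (Hx 0%nat). specialize (Hy 0%nat). specialize (Hin 0%nat). apply Fdiff; lra. }
apply cdiffP in Hd. destruct Hd as [l Hl].
set (D := W + H). assert (HD : 0 < D) by (unfold D; lra).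
(* With this precision the bound of [rect_int_almost_affine] is half of
   [K / 4 ^ n]. *)
set (eps := K / (4 * D ^ 2)).
assert (Heps : 0 < eps) by (apply Rdiv_lt_0_compat; simpl; nra).
destruct (Hl eps Heps) as [r [Hr H']].
assert (Hn : exists n, D / 2 ^ n < r).
{ destruct (pow_lt_1_zero (/ 2)) with (y := r / D) as [n Hn].
  rewrite Rabs_pos_eq; lra. now apply Rdiv_lt_0_compat.
  exists n. specialize (Hn n (le_n _)). rewrite pow_inv in Hn.
  rewrite Rabs_pos_eq in Hn by (left; apply Rinv_0_lt_compat, pow_lt; lra).
  unfold Rdiv. replace r with (D * (r / D)) by (field; lra). now apply Rmult_lt_compat_l. }
destruct Hn as [n Hn].
specialize (Hx n). specialize (Hy n). destruct (Hin n) as [Ix Iy].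
specialize (HWn n). specialize (HHn n).
assert (P2 : 0 < 2 ^ n) by (apply pow_lt; lra).
assert (ED : (fst (q n) + W / 2 ^ n - fst (q n)) + (snd (q n) + H / 2 ^ n - snd (q n)) = D / 2 ^ n).
{ unfold D. field. lra. }
assert (Hb : K / 4 ^ n <= Cmod (rect_at F (W / 2 ^ n) (H / 2 ^ n) (q n))).
{ apply corner_large; trivial.
  - cbn [fst snd]. replace (a + W) with b by (unfold W; ring). replace (c + H) with d by (unfold H; ring).
    intros s t Hs Ht. now apply cdiff_cont, Fdiff.
  - unfold rect_at. cbn [fst snd]. replace (a + W) with b by (unfold W; ring).
    replace (c + H) with d by (unfold H; ring). apply Rle_refl. }
assert (Hs : Cmod (rect_at F (W / 2 ^ n) (H / 2 ^ n) (q n)) <= 2 * eps * (D / 2 ^ n) ^ 2).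
{ rewrite <- ED. apply (rect_int_almost_affine F _ _ _ _ x y (F (x, y)) l eps); try lra.
  - intros s t Hs Ht. apply cdiff_cont, Fdiff; lra.
  - intros s t Hs Ht. apply H'. eapply Rle_lt_trans; [|exact Hn]. rewrite <- ED.
    apply Cmod_rect_diam; lra. }
replace (2 * eps * (D / 2 ^ n) ^ 2) with (K / 4 ^ n / 2) in Hs.
- assert (0 < K / 4 ^ n) by (apply div_pow_pos; lra). lra.
- unfold eps. replace (4 ^ n) with (2 ^ n * 2 ^ n) by (rewrite <- Rpow_mult_distr; f_equal; ring).
  field. lra.
Qed.

(** * The exponential map and the bound at the centre of a disc *)

Definition cexp (s : C) : C := (exp (fst s) * cos (snd s), exp (fst s) * sin (snd s)).

Lemma cexp_plus (s t : C) : cexp (s + t) = (cexp s * cexp t)%C.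
Proof.
unfold cexp. apply injective_projections; simpl; rewrite exp_plus; [rewrite cos_plus|rewrite sin_plus]; ring.
Qed.

Lemma Cmod_cexp (s : C) : Cmod (cexp s) = exp (fst s).
Proof.
unfold Cmod, cexp. cbn [fst snd].
replace (_ + _) with (exp (fst s) ^ 2 * (Rsqr (sin (snd s)) + Rsqr (cos (snd s)))) by (unfold Rsqr; ring).
rewrite sin2_cos2, Rmult_1_r. apply sqrt_pow2. left. apply exp_pos.
Qed.

Lemma cexp_period (x : R) : cexp (x, 2 * PI) = cexp (x, 0).
Proof. unfold cexp. cbn [fst snd]. now rewrite cos_2PI, sin_2PI, cos_0, sin_0. Qed.

Lemma affine_approx (f : R -> R) (l : R) : derivable_pt_lim f 0 l ->
  forall eps, 0 < eps -> exists delta, 0 < delta /\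
    forall h, Rabs h < delta -> Rabs (f h - f 0 - l * h) <= eps * Rabs h.
Proof.
intros H eps He. destruct (H eps He) as [d Hd]. exists d. split; [apply cond_pos|].
intros h Hh. destruct (Req_dec h 0) as [->|n].
- rewrite Rmult_0_r, Rminus_0_r, Rminus_diag, Rabs_R0. lra.
- specialize (Hd h n Hh). rewrite Rplus_0_l in Hd.
  replace (f h - f 0 - l * h) with (((f h - f 0) / h - l) * h) by (field; trivial).
  rewrite Rabs_mult. apply Rmult_le_compat_r; [apply Rabs_pos|lra].
Qed.

Lemma Cmod_le_Re_Im (x y : R) : Cmod (x, y) <= Rabs x + Rabs y.
Proof.
replace (x, y) with ((x, 0%R) + (0%R, y))%C by (apply injective_projections; simpl; ring).
eapply Rle_trans; [apply Cmod_triangle|].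
replace (x, 0%R) with ((x, 0%R) - (0%R, 0%R))%C by (apply injective_projections; simpl; ring).
replace (0, y)%R with ((0%R, y) - (0%R, 0%R))%C by (apply injective_projections; simpl; ring).
rewrite Cmod_hor, Cmod_ver, !Rminus_0_r. lra.
Qed.

Lemma Rabs_fst_le (z : C) : Rabs (fst z) <= Cmod z.
Proof. apply Rle_trans with (2 := Rmax_Cmod z), Rmax_l. Qed.

Lemma Rabs_snd_le (z : C) : Rabs (snd z) <= Cmod z.
Proof. apply Rle_trans with (2 := Rmax_Cmod z), Rmax_r. Qed.

(** The derivative of [exp] at [0] is [1]; the real and imaginary parts are products,
    which are expanded around the real expansions of [exp], [cos] and [sin]. *)
Lemma cexp_approx_0 eps : 0 < eps -> exists delta, 0 < delta /\
  forall h, Cmod h < delta -> Cmod (cexp h - 1 - h) <= eps * Cmod h.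
Proof.
intros He.
set (e := Rmin (eps / 8) 1).
assert (e1 : e <= eps / 8) by apply Rmin_l. assert (e2 : e <= 1) by apply Rmin_r.
assert (e0 : 0 < e) by (apply Rmin_pos; lra). clearbody e.
destruct (affine_approx exp 1) with (eps := e) as [d1 [Hd1 H1]]; trivial.
{ apply derivable_pt_lim_exp_0. }
destruct (affine_approx sin 1) with (eps := e) as [d2 [Hd2 H2]]; trivial.
{ rewrite <- cos_0. apply derivable_pt_lim_sin. }
destruct (affine_approx cos 0) with (eps := e) as [d3 [Hd3 H3]]; trivial.
{ replace 0 with (- sin 0) at 2 by (rewrite sin_0; ring). apply derivable_pt_lim_cos. }
exists (Rmin (Rmin d1 d2) (Rmin d3 e)). split. { repeat apply Rmin_pos; trivial. }
intros [x y] Hh.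
assert (M1 := Rmin_l (Rmin d1 d2) (Rmin d3 e)). assert (M2 := Rmin_r (Rmin d1 d2) (Rmin d3 e)).
assert (M3 := Rmin_l d1 d2). assert (M4 := Rmin_r d1 d2).
assert (M5 := Rmin_l d3 e). assert (M6 := Rmin_r d3 e).
assert (Hx := Rabs_fst_le (x, y)). assert (Hy := Rabs_snd_le (x, y)). cbn [fst snd] in Hx, Hy.
specialize (H1 x ltac:(lra)). specialize (H2 y ltac:(lra)). specialize (H3 y ltac:(lra)).
rewrite exp_0 in H1. rewrite sin_0 in H2. rewrite cos_0 in H3.
replace (cexp (x, y) - 1 - (x, y))%C with (exp x * cos y - 1 - x, exp x * sin y - y)
  by (unfold cexp; apply injective_projections; simpl; ring).
eapply Rle_trans; [apply Cmod_le_Re_Im|].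
set (m := Cmod (x, y)) in *.
assert (C1 : Rabs (cos y) <= 1) by (apply Rabs_le, COS_bound).
assert (A0 := Rabs_pos x). assert (A1 := Rabs_pos y).
assert (A : Rabs (exp x * cos y - 1 - x) <= 3 * e * m).
{ replace (exp x * cos y - 1 - x) with ((exp x - 1 - 1 * x) * cos y + (1 + x) * (cos y - 1 - 0 * y)) by ring.
  eapply Rle_trans; [apply Rabs_triang|]. rewrite !Rabs_mult.
  assert (Rabs (1 + x) <= 2). { eapply Rle_trans; [apply Rabs_triang|]. rewrite Rabs_R1. lra. }
  assert (Rabs (exp x - 1 - 1 * x) * Rabs (cos y) <= (e * Rabs x) * 1)
   by (apply Rmult_le_compat; try apply Rabs_pos; lra).
  assert (Rabs (1 + x) * Rabs (cos y - 1 - 0 * y) <= 2 * (e * Rabs y))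
   by (apply Rmult_le_compat; try apply Rabs_pos; lra).
  nra. }
assert (B : Rabs (exp x * sin y - y) <= 5 * e * m).
{ replace (exp x * sin y - y) with
    (((exp x - 1 - 1 * x) + x) * ((sin y - 0 - 1 * y) + y) + (sin y - 0 - 1 * y)) by ring.
  eapply Rle_trans; [apply Rabs_triang|]. rewrite !Rabs_mult.
  assert (T1 := Rabs_triang (exp x - 1 - 1 * x) x).
  assert (T2 := Rabs_triang (sin y - 0 - 1 * y) y).
  assert (Rabs (exp x - 1 - 1 * x + x) * Rabs (sin y - 0 - 1 * y + y) <= (2 * e) * (2 * m)).
  { apply Rmult_le_compat; try apply Rabs_pos; nra. }
  nra. }
assert (0 <= m) by apply Cmod_ge_0. nra.
Qed.

Lemma cdiff_cexp (z : C) : cdiff cexp z.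
Proof.
apply cdiffP. exists (cexp z). intros eps He.
assert (Hp : 0 < Cmod (cexp z)) by (rewrite Cmod_cexp; apply exp_pos).
destruct (cexp_approx_0 (eps / Cmod (cexp z))) as [d [Hd H]]; [now apply Rdiv_lt_0_compat|].
exists d. split; trivial. intros w Hw. specialize (H _ Hw).
replace (cexp w) with (cexp z * cexp (w - z))%C by (rewrite <- cexp_plus; f_equal; ring).
replace (cexp z * cexp (w - z) - cexp z - cexp z * (w - z))%C with (cexp z * (cexp (w - z) - 1 - (w - z)))%C by ring.
rewrite Cmod_mult.
replace (eps * Cmod (w - z)) with (Cmod (cexp z) * (eps / Cmod (cexp z) * Cmod (w - z))) by (field; lra).
apply Rmult_le_compat_l; lra.
Qed.

(** Goursat's theorem for [k o exp] on the rectangle [[- L, 0] x [0, 2 pi]]: the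
    horizontal sides cancel by periodicity, so [k] has the same mean on the circles
    of radius [1] and [exp (- L)].  The second mean tends to [k 0]. *)
Lemma center_bound (k : C -> C) (B : R) :
  (forall z, Cmod z <= 1 -> cdiff k z) -> (forall z, Cmod z = 1 -> Cmod (k z) <= B) ->
  Cmod (k 0) <= B.
Proof.
intros Hk HB. apply Rle_plus_epsilon. intros eps He.
destruct (proj1 (ccontP k 0) (cdiff_cont k _ (Hk 0 ltac:(rewrite Cmod_0; lra))) eps He) as [r [Hr Hc]].
(* The circle of radius [exp (- L)] lies where [k] is close to [k 0]. *)
set (L := Rmax 1 (- ln (r / 2))).
assert (HL : 1 <= L) by apply Rmax_l.
assert (HL2 : exp (- L) < r).
{ apply Rle_lt_trans with (r / 2); [|lra]. rewrite <- (exp_ln (r / 2)) by lra.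
  assert (H := Rmax_r 1 (- ln (r / 2))). fold L in H.
  destruct (Req_dec (- L) (ln (r / 2))) as [->|]; [lra|]. left. apply exp_increasing. lra. }
set (F := fun s => k (cexp s)).
assert (HPI := PI_RGT_0).
assert (HF : forall x y, - L <= x <= 0 -> 0 <= y <= 2 * PI -> cdiff F (x, y)).
{ intros x y Hx Hy. apply (cdiff_comp k cexp); [|apply cdiff_cexp]. apply Hk. rewrite Cmod_cexp. cbn [fst].
  rewrite <- exp_0. destruct (Req_dec x 0) as [->|]; [lra|]. left. apply exp_increasing. lra. }
assert (HFc : cont_on_rect F (- L) 0 0 (2 * PI)) by (intros x y Hx Hy; now apply cdiff_cont, HF).
assert (HG := goursat F (- L) 0 0 (2 * PI) ltac:(lra) ltac:(lra) HF).
unfold rect_int in HG.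
assert (H0 : CRInt (fun x => F (x, 0) - F (x, (2 * PI)%R))%C (- L) 0 = RtoC 0).
{ apply Cmod_eq_0, Rle_antisym; [|apply Cmod_ge_0].
  assert (H := CRInt_approx (fun x => F (x, 0) - F (x, (2 * PI)%R))%C 0 (- L) 0 0 ltac:(lra)).
  rewrite Cmult_0_r, Rmult_0_r in H.
  replace (CRInt (fun x => F (x, 0) - F (x, (2 * PI)%R))%C (- L) 0 - 0)%C with
    (CRInt (fun x => F (x, 0) - F (x, (2 * PI)%R))%C (- L) 0) in H by ring.
  apply H.
  - intros t Ht. apply rcont_minus; (eapply rcont_hor; [exact HFc|lra|lra]).
  - intros t Ht. unfold F. rewrite cexp_period.
    replace (k (cexp (t, 0)) - k (cexp (t, 0)) - 0)%C with (RtoC 0) by ring. rewrite Cmod_0. lra. }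
rewrite H0 in HG.
set (I := CRInt (fun y => F (0, y) - F ((- L)%R, y))%C 0 (2 * PI)) in *.
assert (HI : I = RtoC 0).
{ replace I with (- Ci * (0 + Ci * I))%C by (apply injective_projections; simpl; ring). rewrite HG. ring. }
assert (H := CRInt_approx (fun y => F (0, y) - F ((- L)%R, y))%C (- k 0) 0 (2 * PI) (B + eps) ltac:(lra)).
fold I in H. rewrite HI in H.
replace (0 - (2 * PI - 0)%R * - k 0)%C with ((2 * PI)%R * k 0)%C in H by (rewrite Rminus_0_r; ring).
rewrite Cmod_mult, Cmod_R, Rabs_pos_eq, Rminus_0_r in H by lra.
apply Rmult_le_reg_l with (2 * PI); [lra|]. apply H.
- intros t Ht. apply rcont_minus; (eapply rcont_ver; [exact HFc|lra|lra]).
- intros t Ht.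
  replace (F (0, t) - F ((- L)%R, t) - - k 0)%C with (F (0, t) + - (F ((- L)%R, t) - k 0))%C by ring.
  eapply Rle_trans; [apply Cmod_triangle|]. rewrite Cmod_opp.
  apply Rplus_le_compat.
  + apply HB. rewrite Cmod_cexp. apply exp_0.
  + left. apply Hc. replace (cexp ((- L)%R, t) - 0)%C with (cexp ((- L)%R, t)) by ring.
    now rewrite Cmod_cexp.
Qed.

(** * Maximum principle, Schwarz lemma and Schwarz-Pick *)

Lemma sq_le (x y : R) : 0 <= y -> x ^ 2 <= y ^ 2 -> x <= y.
Proof. intros. nra. Qed.

(** The automorphism of the disc that moves [a] to the origin; the pseudo-hyperbolic
    distance of [a] and [z] is [Cmod (blaschke a z)]. *)
Definition blaschke (a z : C) : C := ((z - a) / (1 - Cconj a * z))%C.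

Lemma blaschke_den (a z : C) : Cmod a < 1 -> Cmod z <= 1 -> (1 - Cconj a * z <> 0)%C.
Proof.
intros Ha Hz. apply Cmod_gt_0.
assert (H := Cmod_sub_ge 1 (Cconj a * z)). rewrite Cmod_mult, Cmod_conj, Cmod_1 in H.
assert (H0 := Cmod_ge_0 a). assert (H1 := Cmod_ge_0 z). nra.
Qed.

Lemma blaschke_identity (a z : C) :
  Cmod (1 - Cconj a * z) ^ 2 - Cmod (z - a) ^ 2 = (1 - Cmod a ^ 2) * (1 - Cmod z ^ 2).
Proof. rewrite !Cmod2_alt. destruct a, z. unfold Re, Im. simpl. ring. Qed.

Lemma Cmod_blaschke_le (a z : C) : Cmod a < 1 -> Cmod z <= 1 -> Cmod (blaschke a z) <= 1.
Proof.
intros Ha Hz. unfold blaschke. rewrite Cmod_div by now apply blaschke_den.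
assert (Hd := proj1 (Cmod_gt_0 _) (blaschke_den a z Ha Hz)).
apply Rle_div_l; trivial. rewrite Rmult_1_l. apply sq_le; [lra|].
assert (I := blaschke_identity a z).
assert (H0 := Cmod_ge_0 a). assert (H1 := Cmod_ge_0 z).
assert (0 <= (1 - Cmod a ^ 2) * (1 - Cmod z ^ 2)) by (apply Rmult_le_pos; nra). lra.
Qed.

Lemma Cmod_blaschke_lt (a z : C) : Cmod a < 1 -> Cmod z < 1 -> Cmod (blaschke a z) < 1.
Proof.
intros Ha Hz. assert (Hz' : Cmod z <= 1) by lra. unfold blaschke. rewrite Cmod_div by now apply blaschke_den.
assert (Hd := proj1 (Cmod_gt_0 _) (blaschke_den a z Ha Hz')).
apply Rlt_div_l; trivial. rewrite Rmult_1_l.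
assert (I := blaschke_identity a z).
assert (H0 := Cmod_ge_0 a). assert (H1 := Cmod_ge_0 z). assert (H2 := Cmod_ge_0 (z - a)).
assert (0 < (1 - Cmod a ^ 2) * (1 - Cmod z ^ 2)) by (apply Rmult_lt_0_compat; nra). nra.
Qed.

Lemma Cmod_blaschke_eq (a z : C) : Cmod a < 1 -> Cmod z = 1 -> Cmod (blaschke a z) = 1.
Proof.
intros Ha Hz. assert (Hz' : Cmod z <= 1) by lra. unfold blaschke. rewrite Cmod_div by now apply blaschke_den.
assert (Hd := proj1 (Cmod_gt_0 _) (blaschke_den a z Ha Hz')).
assert (I := blaschke_identity a z). rewrite Hz in I.
assert (E : Cmod (z - a) = Cmod (1 - Cconj a * z)).
{ assert (H2 := Cmod_ge_0 (z - a)). apply Rle_antisym; apply sq_le; lra. }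
rewrite E. field. lra.
Qed.

Lemma blaschke_inv (a z : C) : Cmod a < 1 -> Cmod z < 1 -> blaschke (- a) (blaschke a z) = z.
Proof.
intros Ha Hz. unfold blaschke. rewrite Copp_conj.
assert (Hd := blaschke_den a z Ha ltac:(lra)).
assert (H2 := blaschke_den a a Ha ltac:(lra)).
field. split; trivial. match goal with |- ?x <> _ => replace x with (1 - Cconj a * a)%C by ring end. trivial.
Qed.

Lemma blaschke_inv' (a z : C) : Cmod a < 1 -> Cmod z < 1 -> blaschke a (blaschke (- a) z) = z.
Proof.
intros Ha Hz. replace a with (- - a)%C at 1 by ring. apply blaschke_inv; trivial. now rewrite Cmod_opp.
Qed.

Lemma blaschke_self (a : C) : blaschke a a = 0.
Proof. unfold blaschke. replace (a - a)%C with (RtoC 0) by ring. unfold Cdiv. ring. Qed.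

Lemma blaschke_0 (a : C) : blaschke a 0 = (- a)%C.
Proof. unfold blaschke. field. Qed.

Lemma cdiff_blaschke (a z : C) : Cmod a < 1 -> Cmod z <= 1 -> cdiff (blaschke a) z.
Proof.
intros Ha Hz. apply cdiff_div. now apply blaschke_den.
apply cdiff_minus; [apply cdiff_id|apply cdiff_const].
apply cdiff_minus; [apply cdiff_const|]. apply cdiff_mult; [apply cdiff_const|apply cdiff_id].
Qed.

(** A disc automorphism moves [a] to the centre and preserves the boundary circle,
    so [center_bound] is enough. *)
Lemma max_modulus (k : C -> C) (r B : R) (a : C) : 0 < r -> Cmod a < r ->
  (forall z, Cmod z <= r -> cdiff k z) -> (forall z, Cmod z = r -> Cmod (k z) <= B) ->
  Cmod (k a) <= B.
Proof.
intros Hr Ha Hk HB.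
assert (r0 : RtoC r <> 0%C) by (apply Cmod_gt_0; rewrite Cmod_R, Rabs_pos_eq; lra).
assert (Hrz : forall z, Cmod (r * z) = r * Cmod z).
{ intros z. rewrite Cmod_mult, Cmod_R, Rabs_pos_eq; lra. }
(* [blaschke b] sends [0] to [- b = a / r]. *)
set (b := (- (a / r))%C).
assert (Hb : Cmod b < 1).
{ unfold b. rewrite Cmod_opp, Cmod_div, Cmod_R, Rabs_pos_eq by (trivial; lra). apply Rlt_div_l; lra. }
assert (H := center_bound (fun z => k (r * blaschke b z)%C) B).
replace a with (r * blaschke b 0)%C by (rewrite blaschke_0; unfold b; field; trivial).
apply H.
- intros z Hz. apply (cdiff_comp k (fun z => r * blaschke b z)%C).
  + apply Hk. rewrite Hrz. assert (M := Cmod_blaschke_le b z Hb Hz). nra.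
  + apply cdiff_mult; [apply cdiff_const|]. now apply cdiff_blaschke.
- intros z Hz. apply HB. rewrite Hrz, Cmod_blaschke_eq; trivial. lra.
Qed.

Lemma pow_bounded_le_1 (q A : R) : 0 <= q -> (forall n, q ^ n <= A) -> q <= 1.
Proof.
intros Hq H. destruct (Rle_lt_dec q 1) as [|Hlt]; trivial. exfalso.
destruct (Pow_x_infinity q) with (b := A + 1) as [n Hn]. rewrite Rabs_pos_eq; lra.
specialize (Hn n (le_n _)). rewrite Rabs_pos_eq in Hn by now apply pow_le.
specialize (H n). lra.
Qed.

(** Write [f w = h w * w].  The quotient [h] is only known to be continuous at [0],
    but [w * h w ^ n] is differentiable there too, with derivative [h 0 ^ n].  The
    maximum principle for these functions gives
    [|z| |h z| ^ n <= r * (1 / r) ^ n]; taking [n]-th roots kills the factors that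
    do not depend on [n]. *)
Lemma schwarz (f : C -> C) : maps_disc_into_disc f ->
  (forall z, Cmod z < 1 -> cdiff f z) -> f 0 = 0%C ->
  forall z, Cmod z < 1 -> Cmod (f z) <= Cmod z.
Proof.
intros Hm Hf f0 z Hz.
destruct (cdiff_slope f 0 (Hf 0 ltac:(rewrite Cmod_0; lra))) as [h [Hc Hs]].
assert (Hs' : forall w, f w = (h w * w)%C).
{ intros w. specialize (Hs w). rewrite f0 in Hs. replace (f w) with (f w - 0)%C by ring. rewrite Hs. ring. }
clear Hs.
destruct (Ceq_dec z 0) as [->|z0]. { rewrite f0. lra. }
assert (Pz := proj1 (Cmod_gt_0 z) z0).
rewrite Hs', Cmod_mult.
enough (Cmod (h z) <= 1) by nra.
assert (Hk : forall n w, Cmod w < 1 -> cdiff (fun w => w * h w ^ n)%C w).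
{ intros n w Hw. destruct (Ceq_dec w 0) as [->|w0].
  - apply (slope_cdiff _ (fun w => h w ^ n)%C). now apply ccont_pow. intros; ring.
  - assert (Pw := proj1 (Cmod_gt_0 w) w0).
    apply (cdiff_local (fun w => w * (f w / w) ^ n)%C _ _ (Cmod w)); trivial.
    + intros v Hv. replace (f v / v)%C with (h v); trivial. rewrite Hs'. field.
      intros ->. replace (0 - w)%C with (- w)%C in Hv by ring. rewrite Cmod_opp in Hv. lra.
    + apply cdiff_mult; [apply cdiff_id|]. apply cdiff_pow. apply cdiff_div; trivial.
      now apply Hf. apply cdiff_id. }
assert (Hr : forall r, Cmod z < r < 1 -> r * Cmod (h z) <= 1).
{ intros r Hr.
  apply pow_bounded_le_1 with (/ Cmod z * r).
  { assert (H := Cmod_ge_0 (h z)). nra. }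
  intros n.
  assert (H := max_modulus (fun w => w * h w ^ n)%C r (r * (/ r) ^ n) z ltac:(lra) ltac:(lra)
    (fun w Hw => Hk n w ltac:(lra))).
  cbv beta in H. rewrite (Cmod_mult z), Cmod_pow in H.
  rewrite Rpow_mult_distr.
  apply Rmult_le_reg_l with (Cmod z); trivial.
  replace (Cmod z * (/ Cmod z * r)) with (r ^ n * (r * (/ r) ^ n)).
  2:{ rewrite pow_inv. field. repeat split; try apply pow_nonzero; lra. }
  replace (Cmod z * (r ^ n * Cmod (h z) ^ n)) with (r ^ n * (Cmod z * Cmod (h z) ^ n)) by ring.
  apply Rmult_le_compat_l; [apply pow_le; lra|]. apply H.
  intros w Hw. rewrite Cmod_mult, Cmod_pow, Hw. apply Rmult_le_compat_l; [lra|].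
  apply pow_incr. split; [apply Cmod_ge_0|].
  assert (Hfw := Hm w ltac:(unfold unit_disc; lra)). unfold unit_disc in Hfw. rewrite Hs', Cmod_mult, Hw in Hfw.
  apply Rmult_le_reg_r with r; [lra|]. rewrite Rinv_l; lra. }
destruct (Rle_lt_dec (Cmod (h z)) 1) as [|Hlt]; trivial. exfalso.
set (q := Cmod (h z)) in *.
set (r := Rmax ((1 + Cmod z) / 2) ((1 + / q) / 2)).
assert (Hq : / q < 1) by (rewrite <- Rinv_1; apply Rinv_lt_contravar; lra).
assert (Hr1 : r < 1) by (apply Rmax_lub_lt; lra).
assert (R1 := Rmax_l ((1 + Cmod z) / 2) ((1 + / q) / 2)).
assert (R2 := Rmax_r ((1 + Cmod z) / 2) ((1 + / q) / 2)). fold r in R1, R2.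
assert (Hr2 := Hr r ltac:(lra)).
assert (/ q * q = 1) by (field; lra). nra.
Qed.

Lemma schwarz_pick (f : C -> C) : maps_disc_into_disc f ->
  (forall z, Cmod z < 1 -> cdiff f z) ->
  forall z w, Cmod z < 1 -> Cmod w < 1 ->
  Cmod (f z - f w) * Cmod (1 - Cconj w * z) <= Cmod (z - w) * Cmod (1 - Cconj (f w) * f z).
Proof.
intros Hm Hf z w Hz Hw.
assert (Hfz := Hm z Hz). assert (Hfw := Hm w Hw). unfold unit_disc in *.
assert (Hw' : Cmod (- w) < 1) by now rewrite Cmod_opp.
set (G := fun u => blaschke (f w) (f (blaschke (- w) u))).
assert (H : Cmod (G (blaschke w z)) <= Cmod (blaschke w z)).
{ apply schwarz.
  - intros u Hu. unfold G, unit_disc in *. apply Cmod_blaschke_lt; trivial. apply Hm. now apply Cmod_blaschke_lt.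
  - intros u Hu. assert (M := Cmod_blaschke_lt _ u Hw' Hu).
    apply (cdiff_comp (blaschke (f w)) (fun u => f (blaschke (- w) u))).
    + apply cdiff_blaschke; trivial. left. now apply Hm.
    + apply (cdiff_comp f (blaschke (- w))). now apply Hf. apply cdiff_blaschke; trivial; lra.
  - unfold G. rewrite blaschke_0. replace (- - w)%C with w by ring. apply blaschke_self.
  - now apply Cmod_blaschke_lt. }
unfold G in H. rewrite blaschke_inv in H by trivial. unfold blaschke in H.
assert (D1 := blaschke_den _ _ Hfw (Rlt_le _ _ Hfz)). assert (D2 := blaschke_den _ _ Hw (Rlt_le _ _ Hz)).
rewrite !Cmod_div in H by trivial.
apply Cmod_gt_0 in D1. apply Cmod_gt_0 in D2.
set (X := Cmod (1 - Cconj (f w) * f z)) in *. set (Y := Cmod (1 - Cconj w * z)) in *.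
apply (Rmult_le_compat_r (X * Y)) in H; [|nra].
replace (Cmod (f z - f w) / X * (X * Y)) with (Cmod (f z - f w) * Y) in H by (field; lra).
now replace (Cmod (z - w) / Y * (X * Y)) with (Cmod (z - w) * X) in H by (field; lra).
Qed.

(** For [0 < t < 1], Schwarz-Pick at [z] and [t z] bounds [|k z - k (t z)|] by
    [(1 - t) |z|], which is the difference of [|k z|] and [|k (t z)|].  Hence
    [k (t z) = t k z], and [k z / z] is the derivative of [k] at [0]. *)
Lemma schwarz_equality (k : C -> C) : (forall z, Cmod z < 1 -> cdiff k z) ->
  (forall z, Cmod z < 1 -> Cmod (k z) = Cmod z) ->
  exists eta, forall z, Cmod z < 1 -> k z = (eta * z)%C.
Proof.
intros Hk Hm.
assert (H0 : Cmod 0 < 1) by (rewrite Cmod_0; lra).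
assert (k0 : k 0 = 0%C) by (apply Cmod_eq_0; rewrite Hm; trivial; apply Cmod_0).
destruct (cdiff_slope k 0 (Hk 0 H0)) as [h [Hc Hs]].
exists (h 0). intros z Hz.
assert (Hlin : forall t, 0 < t < 1 -> k (t * z)%C = (t * k z)%C).
{ intros t Ht.
  assert (Htz : Cmod (t * z) = t * Cmod z) by (rewrite Cmod_mult, Cmod_R, Rabs_pos_eq; lra).
  assert (Pz := Cmod_ge_0 z).
  assert (Htz1 : Cmod (t * z) < 1) by nra.
  assert (S := schwarz_pick k (fun u Hu => eq_ind_r (fun r => r < 1) Hu (Hm u Hu)) Hk z (t * z)%C Hz Htz1).
  assert (M1 := Hm z Hz). assert (M2 := Hm _ Htz1). rewrite Htz in M2.
  set (u := k z) in *. set (v := k (t * z)%C) in *.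
  assert (I1 := blaschke_identity v u). assert (I2 := blaschke_identity (t * z) z).
  rewrite M1, M2 in I1. rewrite Htz in I2.
  assert (S2 : Cmod (u - v) ^ 2 <= Cmod (z - t * z) ^ 2).
  { set (A := Cmod (u - v) ) in *. set (B := Cmod (z - t * z)) in *.
    set (X := Cmod (1 - Cconj v * u)) in *. set (Y := Cmod (1 - Cconj (t * z) * z)) in *.
    assert (0 <= A) by apply Cmod_ge_0. assert (0 <= B) by apply Cmod_ge_0.
    assert (0 <= X) by apply Cmod_ge_0. assert (0 <= Y) by apply Cmod_ge_0.
    set (D := (1 - (t * Cmod z) ^ 2) * (1 - Cmod z ^ 2)) in *.
    assert (0 < D).
    { assert (Q : 0 <= t * Cmod z < 1) by (rewrite Htz in Htz1; split; nra).
      apply Rmult_lt_0_compat; nra. }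
    assert (S3 : (A * Y) ^ 2 <= (B * X) ^ 2) by (apply pow_incr; split; trivial; nra).
    rewrite !Rpow_mult_distr in S3.
    replace (Y ^ 2) with (D + B ^ 2) in S3 by lra. replace (X ^ 2) with (D + A ^ 2) in S3 by lra.
    nra. }
  assert (E : Cmod (v - t * u) ^ 2 = 0).
  { (* [v] and [t u] have equal moduli, so this identity shows that they coincide as
       soon as [u - v] is short enough. *)
    assert (Id : Cmod (v - t * u) ^ 2
        = (1 - t) * Cmod v ^ 2 - t * (1 - t) * Cmod u ^ 2 + t * Cmod (u - v) ^ 2).
    { rewrite !Cmod2_alt. destruct u, v. unfold Re, Im. simpl. ring. }
    assert (Ez : Cmod (z - t * z) = (1 - t) * Cmod z).
    { replace (z - t * z)%C with (RtoC (1 - t) * z)%C by (rewrite RtoC_minus; ring).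
      rewrite Cmod_mult, Cmod_R, Rabs_pos_eq; lra. }
    rewrite M1, M2 in Id. rewrite Ez in S2.
    assert (t * Cmod (u - v) ^ 2 <= t * ((1 - t) * Cmod z) ^ 2) by (apply Rmult_le_compat_l; lra).
    assert (P := pow2_ge_0 (Cmod (v - t * u))). nra. }
  assert (E2 : Cmod (v - t * u) = 0) by (assert (P := Cmod_ge_0 (v - t * u)); nra).
  apply Cmod_eq_0 in E2. replace v with (v - t * u + t * u)%C by ring. rewrite E2. ring. }
destruct (Ceq_dec z 0) as [->|z0]. { rewrite k0. ring. }
assert (Pz := proj1 (Cmod_gt_0 z) z0).
assert (E : Cmod (k z / z - h 0) = 0).
{ apply Rle_antisym; [|apply Cmod_ge_0]. apply Rle_plus_epsilon. intros eps He. rewrite Rplus_0_l.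
  destruct (proj1 (ccontP h 0) Hc eps He) as [d [Hd H]].
  set (t := Rmin (1 / 2) (d / 2)).
  assert (t1 : t <= 1 / 2) by apply Rmin_l. assert (t2 : t <= d / 2) by apply Rmin_r.
  assert (t0 : 0 < t) by (apply Rmin_pos; lra).
  assert (Ht : (k z / z = h (t * z))%C).
  { specialize (Hs (t * z)%C). rewrite Hlin, k0 in Hs by lra.
    assert (RtoC t <> 0%C) by (apply Cmod_gt_0; rewrite Cmod_R, Rabs_pos_eq; lra).
    replace (k z / z)%C with ((t * k z - 0) / (t * z))%C by (field; auto).
    rewrite Hs. field. auto. }
  rewrite Ht. left. apply H. replace (t * z - 0)%C with (t * z)%C by ring.
  rewrite Cmod_mult, Cmod_R, Rabs_pos_eq; nra. }
apply Cmod_eq_0 in E.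
replace (k z) with ((k z / z - h 0) * z + h 0 * z)%C by (field; trivial). rewrite E. ring.
Qed.

(** * Commuting factors of a Moebius map: interior fixed points *)

(** Multiplying out the denominator turns statements about Moebius maps into
    polynomial identities.  The map may be constant. *)
Definition mobius_on_disc (f : C -> C) : Prop :=
  exists a b c d : C, forall z, Cmod z < 1 ->
    (c * z + d <> 0)%C /\ (f z * (c * z + d) = a * z + b)%C.

Lemma Cmult_integral (x y : C) : (x * y = 0)%C -> x = 0%C \/ y = 0%C.
Proof.
intros H. destruct (Ceq_dec x 0) as [|nx]; [now left|right].
replace y with (/ x * (x * y))%C by (field; trivial). rewrite H. ring.
Qed.

Lemma Csub_eq_0 (x y : C) : (x - y = 0)%C -> x = y.
Proof. intros H. replace x with (x - y + y)%C by ring. rewrite H. ring. Qed.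

Lemma mobius_comp (f g : C -> C) : maps_disc_into_disc g ->
  mobius_on_disc f -> mobius_on_disc g -> mobius_on_disc (fun z => f (g z)).
Proof.
intros Hg [a [b [c [d Hf]]]] [a' [b' [c' [d' Hg']]]].
exists (a * a' + b * c')%C, (a * b' + b * d')%C, (c * a' + d * c')%C, (c * b' + d * d')%C.
intros z Hz. destruct (Hg' z Hz) as [G1 G2]. destruct (Hf (g z) (Hg z Hz)) as [F1 F2].
replace ((c * a' + d * c') * z + (c * b' + d * d'))%C with ((c * g z + d) * (c' * z + d'))%C.
- split; [now apply Cmult_neq_0|].
  rewrite Cmult_assoc, F2.
  replace ((a * g z + b) * (c' * z + d'))%C with (a * (g z * (c' * z + d')) + b * (c' * z + d'))%C by ring.
  rewrite G2. ring.
- replace ((c * g z + d) * (c' * z + d'))%C with (c * (g z * (c' * z + d')) + d * (c' * z + d'))%C by ring.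
  rewrite G2. ring.
Qed.

Lemma mobius_ext (f g : C -> C) : (forall z, Cmod z < 1 -> f z = g z) ->
  mobius_on_disc f -> mobius_on_disc g.
Proof.
intros H [a [b [c [d Hf]]]]. exists a, b, c, d. intros z Hz. rewrite <- H; auto.
Qed.

Lemma mobius_blaschke (s : C) : Cmod s < 1 -> mobius_on_disc (blaschke s).
Proof.
intros Hs. exists 1%C, (- s)%C, (- Cconj s)%C, 1%C. intros z Hz.
assert (D := blaschke_den s z Hs (Rlt_le _ _ Hz)).
replace (- Cconj s * z + 1)%C with (1 - Cconj s * z)%C by ring. split; trivial.
unfold blaschke. field. trivial.
Qed.

(** The hypothesis says that [f] preserves distances to [0] for a metric of the form
    [|z - w| / |B(z, w)|] with [B] affine in [z]: this covers the hyperbolic metric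
    of a disc and of a half-plane, and the Euclidean metric of a plane, in any
    Moebius coordinate.  It makes [k z = (f z - f 0) (b0 + b1 z) / (c0 + c1 f z)]
    satisfy [|k z| = |z|], so [k] is linear, and the equation can be solved for
    [f z]. *)
Lemma mobius_rigidity (f : C -> C) (b0 b1 c0 c1 : C) :
  (forall z, Cmod z < 1 -> cdiff f z) ->
  (forall z, Cmod z < 1 -> b0 + b1 * z <> 0)%C ->
  (forall z, Cmod z < 1 -> c0 + c1 * f z <> 0)%C ->
  (forall z, Cmod z < 1 ->
     Cmod (f z - f 0) * Cmod (b0 + b1 * z) = Cmod z * Cmod (c0 + c1 * f z)) ->
  mobius_on_disc f.
Proof.
intros Hf Hb Hc H.
destruct (schwarz_equality (fun z => (f z - f 0) * (b0 + b1 * z) / (c0 + c1 * f z))%C) as [eta He].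
- intros z Hz. apply cdiff_div; auto.
  + apply cdiff_mult. apply cdiff_minus; [auto|apply cdiff_const].
    apply cdiff_plus; [apply cdiff_const|]. apply cdiff_mult; [apply cdiff_const|apply cdiff_id].
  + apply cdiff_plus; [apply cdiff_const|]. apply cdiff_mult; [apply cdiff_const|auto].
- intros z Hz. rewrite Cmod_div, Cmod_mult by auto. rewrite H by trivial. field.
  assert (P := proj1 (Cmod_gt_0 _) (Hc z Hz)). lra.
- assert (H0 : Cmod 0 < 1) by (rewrite Cmod_0; lra).
  exists (f 0 * b1 + eta * c0)%C, (f 0 * b0)%C, (b1 - eta * c1)%C, b0. intros z Hz.
  assert (E : ((f z - f 0) * (b0 + b1 * z) = eta * z * (c0 + c1 * f z))%C).
  { rewrite <- He by trivial. field. auto. }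
  split.
  + intros Z.
    assert (Q : (eta * z * (c0 + c1 * f 0) = 0)%C).
    { replace (eta * z * (c0 + c1 * f 0))%C with
      (f z * ((b1 - eta * c1) * z + b0) - f 0 * ((b1 - eta * c1) * z + b0)
       - ((f z - f 0) * (b0 + b1 * z) - eta * z * (c0 + c1 * f z)))%C by ring.
      rewrite Z, E. ring. }
    apply Cmult_integral in Q. destruct Q as [Q|Q]; [|now apply (Hc 0 H0)].
    apply (Hb z Hz). replace (b0 + b1 * z)%C with ((b1 - eta * c1) * z + b0 + c1 * (eta * z))%C by ring.
    rewrite Z, Q. ring.
  + apply Csub_eq_0.
    replace (f z * ((b1 - eta * c1) * z + b0) - ((f 0 * b1 + eta * c0) * z + f 0 * b0))%C
     with ((f z - f 0) * (b0 + b1 * z) - eta * z * (c0 + c1 * f z))%C by ring.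
    rewrite E. ring.
Qed.

(** Injectivity of [m] excludes the constant maps among the Moebius maps. *)
Record mobius_factorization (f g m : C -> C) : Prop := {
  fact_f_disc : maps_disc_into_disc f;
  fact_g_disc : maps_disc_into_disc g;
  fact_f_diff : forall z, Cmod z < 1 -> cdiff f z;
  fact_g_diff : forall z, Cmod z < 1 -> cdiff g z;
  fact_fg : forall z, Cmod z < 1 -> f (g z) = m z;
  fact_gf : forall z, Cmod z < 1 -> g (f z) = m z;
  fact_inj : forall z w, Cmod z < 1 -> Cmod w < 1 -> m z = m w -> z = w
}.

Lemma fact_m_disc f g m : mobius_factorization f g m -> maps_disc_into_disc m.
Proof.
intros H z Hz. rewrite <- (fact_fg _ _ _ H) by trivial.
now apply (fact_f_disc _ _ _ H), (fact_g_disc _ _ _ H).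
Qed.

Lemma fact_commute f g m z : mobius_factorization f g m -> Cmod z < 1 -> f (m z) = m (f z).
Proof.
intros H Hz. rewrite <- (fact_gf _ _ _ H) by trivial.
apply (fact_fg _ _ _ H). now apply (fact_f_disc _ _ _ H).
Qed.

(** The automorphism and its inverse are given together: conjugation needs both. *)
Record disc_automorphism (psi psi' : C -> C) : Prop := {
  aut_disc : maps_disc_into_disc psi;
  aut_disc' : maps_disc_into_disc psi';
  aut_diff : forall z, Cmod z < 1 -> cdiff psi z;
  aut_diff' : forall z, Cmod z < 1 -> cdiff psi' z;
  aut_mobius : mobius_on_disc psi;
  aut_mobius' : mobius_on_disc psi';
  aut_inv : forall z, Cmod z < 1 -> psi (psi' z) = z;
  aut_inv' : forall z, Cmod z < 1 -> psi' (psi z) = z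
}.

Lemma aut_blaschke s : Cmod s < 1 -> disc_automorphism (blaschke (- s)) (blaschke s).
Proof.
intros Hs. assert (Hs' : Cmod (- s) < 1) by now rewrite Cmod_opp.
split; try (now apply mobius_blaschke); intros z Hz; try (apply cdiff_blaschke; trivial; lra).
- now apply Cmod_blaschke_lt.
- now apply Cmod_blaschke_lt.
- now apply blaschke_inv.
- now apply blaschke_inv'.
Qed.

Lemma Cmod1_conj (p : C) : Cmod p = 1 -> (Cconj p * p = 1)%C.
Proof. intros H. rewrite Cmult_comm, <- Cmod2_conj, H. now rewrite pow1. Qed.

Lemma aut_rotation p : Cmod p = 1 ->
  disc_automorphism (fun z => p * z)%C (fun z => Cconj p * z)%C.
Proof.
intros Hp. assert (Hp' := Cmod1_conj p Hp).
assert (Hm : forall q, mobius_on_disc (fun z => q * z)%C).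
{ intros q. exists q, 0%C, 0%C, 1%C. intros z _. replace (0 * z + 1)%C with (RtoC 1) by ring.
  split; [apply C1_nz|ring]. }
split; try apply Hm; intros z Hz; unfold unit_disc in *.
- rewrite Cmod_mult, Hp. lra.
- rewrite Cmod_mult, Cmod_conj, Hp. lra.
- apply cdiff_mult; [apply cdiff_const|apply cdiff_id].
- apply cdiff_mult; [apply cdiff_const|apply cdiff_id].
- transitivity ((Cconj p * p) * z)%C; [ring|]. rewrite Hp'. ring.
- transitivity ((Cconj p * p) * z)%C; [ring|]. rewrite Hp'. ring.
Qed.

Lemma fact_conjugate psi psi' f g m : disc_automorphism psi psi' -> mobius_factorization f g m ->
  mobius_factorization (fun z => psi' (f (psi z))) (fun z => psi' (g (psi z)))
    (fun z => psi' (m (psi z))).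
Proof.
intros [A1 A2 A3 A4 A5 A6 A7 A8] [F1 F2 F3 F4 F5 F6 F7].
split.
- intros z Hz. now apply A2, F1, A1.
- intros z Hz. now apply A2, F2, A1.
- intros z Hz. apply (cdiff_comp psi' (fun z => f (psi z))). now apply A4, F1, A1.
  apply (cdiff_comp f psi); auto. now apply F3, A1.
- intros z Hz. apply (cdiff_comp psi' (fun z => g (psi z))). now apply A4, F2, A1.
  apply (cdiff_comp g psi); auto. now apply F4, A1.
- intros z Hz. rewrite A7 by now apply F2, A1. rewrite F5; trivial. now apply A1.
- intros z Hz. rewrite A7 by now apply F1, A1. rewrite F6; trivial. now apply A1.
- assert (Mm : forall z, Cmod z < 1 -> Cmod (m z) < 1).
  { intros z Hz. rewrite <- F5 by trivial. now apply F1, F2. }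
  intros z w Hz Hw E. rewrite <- (A8 z), <- (A8 w) by trivial. f_equal.
  apply F7. now apply A1. now apply A1.
  rewrite <- (A7 (m (psi z))), <- (A7 (m (psi w))). now rewrite E. now apply Mm, A1. now apply Mm, A1.
Qed.

Lemma mobius_of_conjugate psi psi' f : disc_automorphism psi psi' -> maps_disc_into_disc f ->
  mobius_on_disc (fun z => psi' (f (psi z))) -> mobius_on_disc f.
Proof.
intros A Hf H.
apply (mobius_ext (fun z => psi (psi' (f (psi (psi' z)))))).
- intros z Hz. rewrite (aut_inv _ _ A z Hz). apply (aut_inv _ _ A). now apply Hf.
- apply (mobius_comp psi (fun z => psi' (f (psi (psi' z))))).
  + intros z Hz. now apply (aut_disc' _ _ A), Hf, (aut_disc _ _ A), (aut_disc' _ _ A).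
  + apply (aut_mobius _ _ A).
  + apply (mobius_comp (fun z => psi' (f (psi z))) psi'); trivial.
    apply (aut_disc' _ _ A). apply (aut_mobius' _ _ A).
Qed.

(** The direction in which [1 + x z] decreases fastest in modulus. *)
Lemma unit_direction (x : C) : exists u, Cmod u = 1 /\ (x * u = - Cmod x)%C.
Proof.
destruct (Ceq_dec x 0) as [->|n].
- exists 1%C. split; [apply Cmod_1|]. rewrite Cmod_0. ring.
- assert (P := proj1 (Cmod_gt_0 x) n).
  assert (n' : RtoC (Cmod x) <> 0%C) by (apply Cmod_gt_0; rewrite Cmod_R, Rabs_pos_eq; lra).
  exists (- (Cconj x / Cmod x))%C. split.
  + rewrite Cmod_opp, Cmod_div, Cmod_conj, Cmod_R, Rabs_pos_eq by (trivial; lra). field. lra.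
  + replace (x * - (Cconj x / Cmod x))%C with (- (x * Cconj x) / Cmod x)%C by (field; trivial).
    rewrite <- Cmod2_conj, RtoC_pow. field. trivial.
Qed.

Lemma le_1_of_scaled (x : R) : (forall r, 0 < r < 1 -> r * x <= 1) -> x <= 1.
Proof.
intros H. destruct (Rle_lt_dec x 1) as [|Hx]; trivial. exfalso.
assert (Hi : / x < 1) by (rewrite <- Rinv_1; apply Rinv_lt_contravar; lra).
assert (0 < / x) by (apply Rinv_0_lt_compat; lra).
specialize (H ((1 + / x) / 2) ltac:(lra)).
assert (/ x * x = 1) by (field; lra). nra.
Qed.

Lemma RtoC_neq_0 (r : R) : r <> 0 -> RtoC r <> 0%C.
Proof. intros H E. apply H. now injection E. Qed.

(** The bound [|mu z| < |1 + ga z|] is strongest where [ga z] is real and negative,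
    and there it reads [r |mu| < 1 - r |ga|]. *)
Lemma fixing_origin_coefs m mu ga : (forall z, Cmod z < 1 -> Cmod (m z) < 1) ->
  (forall z, Cmod z < 1 -> (1 + ga * z <> 0)%C /\ (m z * (1 + ga * z) = mu * z)%C) ->
  Cmod mu + Cmod ga <= 1.
Proof.
intros Hm H.
assert (Hg : Cmod ga <= 1).
{ destruct (Rle_lt_dec (Cmod ga) 1) as [|Hx]; trivial. exfalso.
  assert (n : ga <> 0%C) by (apply Cmod_gt_0; lra).
  destruct (H (- / ga)%C) as [N _].
  - rewrite Cmod_opp, Cmod_inv by trivial. rewrite <- Rinv_1. apply Rinv_lt_contravar; lra.
  - apply N. field. trivial. }
apply le_1_of_scaled. intros r Hr.
destruct (unit_direction ga) as [u [Hu E]].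
assert (Hz : Cmod (r * u) < 1) by (rewrite Cmod_mult, Cmod_R, Hu, Rabs_pos_eq; lra).
destruct (H _ Hz) as [_ E2]. apply (f_equal Cmod) in E2.
replace (1 + ga * (r * u))%C with (RtoC (1 - r * Cmod ga)) in E2.
2:{ replace (ga * (r * u))%C with (r * (ga * u))%C by ring. rewrite E, RtoC_minus, RtoC_mult. ring. }
assert (P1 := Cmod_ge_0 ga).
assert (P2 : 0 <= 1 - r * Cmod ga) by nra.
rewrite !Cmod_mult, Hu, !Cmod_R, (Rabs_pos_eq r), (Rabs_pos_eq (1 - _)) in E2 by lra.
specialize (Hm _ Hz). assert (P := Cmod_ge_0 mu). nra.
Qed.

Lemma iter_disc m n z : (forall z, Cmod z < 1 -> Cmod (m z) < 1) -> Cmod z < 1 ->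
  Cmod (Nat.iter n m z) < 1.
Proof. intros H Hz. induction n; simpl; auto. Qed.

Lemma iter_commute f m n z : (forall z, Cmod z < 1 -> Cmod (m z) < 1) ->
  (forall z, Cmod z < 1 -> f (m z) = m (f z)) -> Cmod z < 1 ->
  f (Nat.iter n m z) = Nat.iter n m (f z).
Proof.
intros Hm H Hz. induction n; simpl; auto. rewrite H. now rewrite IHn. now apply iter_disc.
Qed.

(** The coordinate [U z = z / (1 - ka z)] sends the other fixed point [1 / ka] of [m]
    to infinity, and [fixing_origin_coefs] puts that point outside the open disc.  In
    this coordinate [m] is multiplication by [mu].  By commutation [U (f z) / U z]
    does not change when [z] is replaced by its iterates, which tend to [0]. *)
Lemma mobius_attracting f m mu ga : maps_disc_into_disc f ->
  (forall z, Cmod z < 1 -> cdiff f z) -> (forall z, Cmod z < 1 -> Cmod (m z) < 1) ->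
  (forall z, Cmod z < 1 -> f (m z) = m (f z)) ->
  (forall z, Cmod z < 1 -> (1 + ga * z <> 0)%C /\ (m z * (1 + ga * z) = mu * z)%C) ->
  mu <> 0%C -> Cmod mu < 1 -> mobius_on_disc f.
Proof.
intros Hf Hd Hm Hcom H mu0 Hmu.
assert (Hsum := fixing_origin_coefs m mu ga Hm H).
assert (H0 : Cmod 0 < 1) by (rewrite Cmod_0; lra).
assert (n1 : (mu - 1 <> 0)%C).
{ intros E. apply Csub_eq_0 in E. rewrite E, Cmod_1 in Hmu. lra. }
set (ka := (ga / (mu - 1))%C).
assert (Hka : Cmod ka <= 1).
{ unfold ka. rewrite Cmod_div by trivial. apply Rle_div_l. now apply Cmod_gt_0.
  assert (T := Cmod_sub_ge 1 mu). rewrite Cmod_1, Cmod_sub_sym in T. lra. }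
assert (Hden : forall z, Cmod z < 1 -> (1 - ka * z <> 0)%C).
{ intros z Hz. apply Cmod_gt_0. assert (T := Cmod_sub_ge 1 (ka * z)).
  rewrite Cmod_1, Cmod_mult in T. assert (P := Cmod_ge_0 z). nra. }
set (U := fun z => (z / (1 - ka * z))%C).
assert (HU : forall z, Cmod z < 1 -> U (m z) = (mu * U z)%C).
{ intros z Hz. destruct (H z Hz) as [N E].
  assert (D := Hden _ (Hm z Hz)). assert (D' := Hden z Hz). unfold U.
  assert (Em : m z = (mu * z / (1 + ga * z))%C) by (rewrite <- E; field; trivial).
  assert (Eg : ga = (ka * (mu - 1))%C) by (unfold ka; field; trivial).
  rewrite Em in D |- *. clearbody ka. subst ga. field. repeat split; trivial. }
assert (HUn : forall n z, Cmod z < 1 -> U (Nat.iter n m z) = (mu ^ n * U z)%C).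
{ intros n z Hz. induction n; simpl; [ring|]. rewrite HU by now apply iter_disc. rewrite IHn. ring. }
assert (m0 : m 0 = 0%C).
{ destruct (H 0 H0) as [N E]. rewrite Cmult_0_r in *. rewrite Cmult_0_r in E.
  replace (m 0) with (m 0 * (1 + 0))%C by ring. trivial. }
assert (f0 : f 0 = 0%C).
{ assert (E := HU (f 0) (Hf 0 H0)). rewrite <- Hcom, m0 in E by trivial.
  assert (Z : ((mu - 1) * U (f 0) = 0)%C).
  { replace ((mu - 1) * U (f 0))%C with (mu * U (f 0) - U (f 0))%C by ring. rewrite <- E. ring. }
  apply Cmult_integral in Z. destruct Z as [Z|Z]; [contradiction|].
  unfold U in Z. assert (D := Hden _ (Hf 0 H0)).
  replace (f 0) with (f 0 / (1 - ka * f 0) * (1 - ka * f 0))%C by (field; trivial). rewrite Z. ring. }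
destruct (cdiff_slope f 0 (Hd 0 H0)) as [h [Hc Hs]].
(* [Th w] is [U (f w) / U w], continued to [w = 0] by the derivative of [f]. *)
set (Th := fun w => (h w * (1 - ka * w) / (1 - ka * f w))%C).
assert (HTh : ccont Th 0).
{ apply ccont_div. rewrite f0. replace (1 - ka * 0)%C with (RtoC 1) by ring. apply C1_nz.
  apply ccont_mult; trivial. apply ccont_minus; [apply ccont_const|].
  apply ccont_mult; [apply ccont_const|apply ccont_id].
  apply ccont_minus; [apply ccont_const|].
  apply ccont_mult; [apply ccont_const|]. apply cdiff_cont. auto. }
assert (HUf : forall w, Cmod w < 1 -> U (f w) = (U w * Th w)%C).
{ intros w Hw. unfold U, Th. specialize (Hs w). rewrite f0 in Hs.
  assert (D1 := Hden _ Hw). assert (D2 := Hden _ (Hf w Hw)).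
  assert (E : f w = (h w * w)%C) by (replace (f w) with (f w - 0)%C by ring; rewrite Hs; ring).
  rewrite E at 1. field. auto. }
assert (Hcst : forall n z, Cmod z < 1 -> U (f z) = (U z * Th (Nat.iter n m z))%C).
{ intros n z Hz. assert (Hzn := iter_disc m n z Hm Hz).
  assert (E := HUf _ Hzn). rewrite (iter_commute f m n z Hm Hcom Hz) in E.
  rewrite HUn, HUn in E; trivial; [|now apply Hf].
  assert (mun := Cpow_nz mu n mu0).
  replace (U (f z)) with (/ mu ^ n * (mu ^ n * U (f z)))%C by (field; trivial).
  rewrite E. field. trivial. }
assert (Hlim : forall z, Cmod z < 1 -> forall eps, 0 < eps -> exists n, Cmod (Nat.iter n m z) < eps).
{ intros z Hz eps He.
  destruct (pow_lt_1_zero (Cmod mu)) with (y := eps / (2 * (Cmod (U z) + 1))) as [n Hn].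
  - rewrite Rabs_pos_eq; trivial. apply Cmod_ge_0.
  - apply Rdiv_lt_0_compat; trivial. assert (P := Cmod_ge_0 (U z)). lra.
  - exists n. specialize (Hn n (le_n _)). rewrite Rabs_pos_eq in Hn by (apply pow_le, Cmod_ge_0).
    assert (Hzn := iter_disc m n z Hm Hz). assert (E := HUn n z Hz).
    set (w := Nat.iter n m z) in *. assert (D := Hden w Hzn).
    assert (Ew : w = (mu ^ n * U z * (1 - ka * w))%C) by (rewrite <- E; unfold U; field; trivial).
    rewrite Ew, !Cmod_mult, Cmod_pow.
    assert (B : Cmod (1 - ka * w) <= 2).
    { assert (T := Cmod_triangle 1 (- (ka * w))). rewrite Cmod_opp, Cmod_1, Cmod_mult in T.
      assert (P1 := Cmod_ge_0 ka). assert (P2 := Cmod_ge_0 w).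
      replace (1 - ka * w)%C with (1 + - (ka * w))%C by ring. nra. }
    assert (P := Cmod_ge_0 (U z)).
    assert (P3 : 0 <= Cmod mu ^ n) by (apply pow_le, Cmod_ge_0).
    assert (P4 := Cmod_ge_0 (1 - ka * w)).
    apply Rlt_div_r in Hn; [|lra].
    apply Rle_lt_trans with (Cmod mu ^ n * Cmod (U z) * 2); [|nra].
    apply Rmult_le_compat_l; trivial. now apply Rmult_le_pos. }
set (nu := Th 0%C).
assert (Hfin : forall z, Cmod z < 1 -> U (f z) = (nu * U z)%C).
{ intros z Hz. apply Csub_eq_0, Cmod_eq_0, Rle_antisym; [|apply Cmod_ge_0].
  apply Rle_plus_epsilon. intros eps He. rewrite Rplus_0_l.
  assert (P := Cmod_ge_0 (U z)).
  destruct (proj1 (ccontP Th 0) HTh (eps / (Cmod (U z) + 1))) as [d [Hd0 Hd1]].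
  { apply Rdiv_lt_0_compat; lra. }
  destruct (Hlim z Hz d Hd0) as [n Hn].
  rewrite (Hcst n z Hz). specialize (Hd1 (Nat.iter n m z)).
  replace (Nat.iter n m z - 0)%C with (Nat.iter n m z) in Hd1 by ring. specialize (Hd1 Hn).
  set (v := Th (Nat.iter n m z)) in *. fold nu in Hd1.
  replace (U z * v - nu * U z)%C with (U z * (v - nu))%C by ring. rewrite Cmod_mult.
  apply Rlt_div_r in Hd1; [|lra]. assert (P2 := Cmod_ge_0 (v - nu)). nra. }
exists nu, 0%C, (nu * ka - ka)%C, 1%C. intros z Hz.
assert (D1 := Hden _ Hz). assert (D2 := Hden _ (Hf z Hz)).
assert (E : (f z * (1 - ka * z) = nu * z * (1 - ka * f z))%C).
{ specialize (Hfin z Hz). unfold U in Hfin.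
  replace (f z) with (f z / (1 - ka * f z) * (1 - ka * f z))%C at 1 by (field; trivial).
  rewrite Hfin. field. trivial. }
assert (E2 : (f z * ((nu * ka - ka) * z + 1) = nu * z + 0)%C).
{ apply Csub_eq_0.
  replace (f z * ((nu * ka - ka) * z + 1) - (nu * z + 0))%C with
   (f z * (1 - ka * z) - nu * z * (1 - ka * f z))%C by ring. rewrite E. ring. }
split; trivial. intros Z. rewrite Z in E2. apply D1.
replace (1 - ka * z)%C with ((nu * ka - ka) * z + 1 - ka * (nu * z + 0))%C by ring.
rewrite Z, <- E2. ring.
Qed.

(** Here [m] preserves distances, so the Schwarz-Pick inequalities of [f] and [g]
    are both equalities. *)
Lemma mobius_rotation_root f g m mu : mobius_factorization f g m ->
  (forall z, Cmod z < 1 -> m z = mu * z)%C -> Cmod mu = 1 -> mobius_on_disc f.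
Proof.
intros H Hm Hmu.
assert (Hf := fact_f_disc _ _ _ H). assert (Hg := fact_g_disc _ _ _ H).
assert (H0 : Cmod 0 < 1) by (rewrite Cmod_0; lra).
apply (mobius_rigidity f 1 0 1 (- Cconj (f 0))).
- apply (fact_f_diff _ _ _ H).
- intros z _. replace (1 + 0 * z)%C with (RtoC 1) by ring. apply C1_nz.
- intros z Hz. replace (1 + - Cconj (f 0) * f z)%C with (1 - Cconj (f 0) * f z)%C by ring.
  apply blaschke_den. now apply Hf. left. now apply Hf.
- intros z Hz. replace (1 + 0 * z)%C with (RtoC 1) by ring. rewrite Cmod_1, Rmult_1_r.
  replace (1 + - Cconj (f 0) * f z)%C with (1 - Cconj (f 0) * f z)%C by ring.
  apply Rle_antisym.
  + assert (S := schwarz_pick f Hf (fact_f_diff _ _ _ H) z 0 Hz H0).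
    replace (1 - Cconj 0 * z)%C with (RtoC 1) in S by (apply injective_projections; simpl; ring).
    replace (z - 0)%C with z in S by ring. now rewrite Cmod_1, Rmult_1_r in S.
  + assert (S := schwarz_pick g Hg (fact_g_diff _ _ _ H) (f z) (f 0) (Hf z Hz) (Hf 0 H0)).
    rewrite !(fact_gf _ _ _ H), !Hm in S by trivial.
    replace (1 - Cconj (mu * 0) * (mu * z))%C with (RtoC 1) in S by (apply injective_projections; simpl; ring).
    replace (mu * z - mu * 0)%C with (mu * z)%C in S by ring.
    now rewrite Cmod_1, Rmult_1_r, Cmod_mult, Hmu, Rmult_1_l in S.
Qed.

(** The bound [|mu| + |ga| <= 1] leaves two cases: [|mu| < 1], where the origin
    attracts, and [|mu| = 1], which forces [ga = 0] and makes [m] a rotation. *)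
Lemma mobius_root_fixing_origin f g m : mobius_factorization f g m -> mobius_on_disc m ->
  m 0 = 0%C -> mobius_on_disc f.
Proof.
intros H [a [b [c [d Hm]]]] m0.
assert (H0 : Cmod 0 < 1) by (rewrite Cmod_0; lra).
destruct (Hm 0 H0) as [N E]. rewrite m0 in E.
assert (b0 : b = 0%C) by (replace b with (a * 0 + b)%C by ring; rewrite <- E; ring).
assert (d0 : d <> 0%C) by (intros ->; apply N; ring).
assert (Hn : forall z, Cmod z < 1 -> (1 + c / d * z <> 0)%C /\ (m z * (1 + c / d * z) = a / d * z)%C).
{ intros z Hz. destruct (Hm z Hz) as [N1 E1]. split.
  - replace (1 + c / d * z)%C with ((c * z + d) / d)%C by (field; trivial).
    apply Cmult_neq_0; trivial. intros Z. apply C1_nz. rewrite <- (Cinv_r d d0), Z. ring.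
  - replace (m z * (1 + c / d * z))%C with (m z * (c * z + d) / d)%C by (field; trivial).
    rewrite E1, b0. field. trivial. }
assert (Hmd := fact_m_disc _ _ _ H).
assert (Hsum := fixing_origin_coefs m _ _ Hmd Hn).
assert (P := Cmod_ge_0 (c / d)).
destruct (Rle_lt_or_eq_dec (Cmod (a / d)) 1) as [Hlt|Heq]; [lra| |].
- apply (mobius_attracting f m (a / d) (c / d)); trivial.
  + apply (fact_f_disc _ _ _ H). + apply (fact_f_diff _ _ _ H).
  + intros z Hz. apply (fact_commute _ _ _ _ H Hz).
  + intros Z.
    assert (Zm : forall z, Cmod z < 1 -> m z = 0%C).
    { intros z Hz. destruct (Hn z Hz) as [N1 E1]. rewrite Z, Cmult_0_l in E1.
      apply Cmult_integral in E1. now destruct E1. }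
    assert (H2 : Cmod (RtoC (1 / 2)) < 1) by (rewrite Cmod_R, Rabs_pos_eq; lra).
    assert (Q := fact_inj _ _ _ H _ _ H0 H2 ltac:(now rewrite !Zm)). injection Q. lra.
- apply (mobius_rotation_root f g m (a / d)); trivial.
  intros z Hz. destruct (Hn z Hz) as [_ E1].
  assert (Z : (c / d)%C = 0%C) by (apply Cmod_eq_0; lra).
  rewrite Z in E1. rewrite <- E1. ring.
Qed.

Lemma mobius_root_fixing_interior f g m p : mobius_factorization f g m -> mobius_on_disc m ->
  Cmod p < 1 -> m p = p -> mobius_on_disc f.
Proof.
intros H Hm Hp E. assert (A := aut_blaschke p Hp).
apply (mobius_of_conjugate _ _ _ A). apply (fact_f_disc _ _ _ H).
assert (Hp' : Cmod (- p) < 1) by now rewrite Cmod_opp.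
apply (mobius_root_fixing_origin _ _ _ (fact_conjugate _ _ _ _ _ A H)).
- apply (mobius_comp (blaschke p) (fun z => m (blaschke (- p) z))).
  + intros z Hz. now apply (fact_m_disc _ _ _ H), Cmod_blaschke_lt.
  + now apply mobius_blaschke.
  + apply (mobius_comp m (blaschke (- p))); trivial.
    * intros z Hz. now apply Cmod_blaschke_lt.
    * now apply mobius_blaschke.
- rewrite blaschke_0. replace (- - p)%C with p by ring. rewrite E. apply blaschke_self.
Qed.

(** * The right half-plane model *)

(** The Cayley map from the disc to the right half-plane; it sends [1] to infinity,
    so Moebius self-maps fixing [1] become affine. *)
Definition cayley (z : C) : C := ((1 + z) / (1 - z))%C.

Lemma one_minus_nz (z : C) : Cmod z < 1 -> (1 - z <> 0)%C.
Proof. intros H E. apply Csub_eq_0 in E. rewrite <- E, Cmod_1 in H. lra. Qed.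

Lemma cayley_sub (z w : C) : Cmod z < 1 -> Cmod w < 1 ->
  (cayley z - cayley w = 2 * (z - w) / ((1 - z) * (1 - w)))%C.
Proof. intros Hz Hw. unfold cayley. field. split; now apply one_minus_nz. Qed.

Lemma cayley_add_conj (z w : C) : Cmod z < 1 -> Cmod w < 1 ->
  (cayley z + Cconj (cayley w) = 2 * (1 - Cconj w * z) / ((1 - z) * Cconj (1 - w)))%C.
Proof.
intros Hz Hw. unfold cayley.
assert (Hw' : Cmod (Cconj w) < 1) by now rewrite Cmod_conj.
rewrite Cdiv_conj by now apply one_minus_nz. rewrite Cplus_conj, Cminus_conj.
replace (Cconj 1) with (RtoC 1) by (apply injective_projections; simpl; ring).
field. split; now apply one_minus_nz.
Qed.

Lemma Re_cayley (z : C) : Cmod z < 1 -> 0 < Re (cayley z).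
Proof.
intros Hz. assert (N := one_minus_nz z Hz).
assert (E := cayley_add_conj z z Hz Hz).
rewrite <- Cmod2_conj in E. rewrite Cmult_comm with (x := Cconj z), <- Cmod2_conj in E.
assert (P := proj1 (Cmod_gt_0 _) N). assert (P1 := Cmod_ge_0 z).
assert (P2 : 0 < Cmod (1 - z) ^ 2) by (apply pow_lt; trivial).
assert (Er : (cayley z + Cconj (cayley z))%C = RtoC (2 * (1 - Cmod z ^ 2) / Cmod (1 - z) ^ 2)).
{ rewrite E. rewrite RtoC_div, RtoC_mult, RtoC_minus by lra. reflexivity. }
apply (f_equal fst) in Er. simpl fst in Er. unfold Re in *.
assert (0 < 2 * (1 - Cmod z ^ 2) / Cmod (1 - z) ^ 2) by (apply Rdiv_lt_0_compat; nra). simpl in *. lra.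
Qed.

Lemma cayley_surj (w : C) : 0 < Re w -> exists z, Cmod z < 1 /\ cayley z = w.
Proof.
intros Hw.
assert (N : (w + 1 <> 0)%C).
{ intros E. apply (f_equal fst) in E. unfold Re in Hw. simpl in E. lra. }
exists ((w - 1) / (w + 1))%C. split.
- rewrite Cmod_div by trivial. assert (P := proj1 (Cmod_gt_0 _) N). apply Rlt_div_l; trivial.
  rewrite Rmult_1_l.
  assert (E : Cmod (w + 1) ^ 2 - Cmod (w - 1) ^ 2 = 4 * Re w).
  { rewrite !Cmod2_alt. destruct w. unfold Re, Im. simpl. ring. }
  assert (P2 := Cmod_ge_0 (w - 1)). nra.
- unfold cayley. assert (T : RtoC 2 <> RtoC 0) by (apply RtoC_neq_0; lra).
  field. split; trivial. replace (w + 1 - (w - 1))%C with (RtoC 2); trivial.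
  apply injective_projections; simpl; ring.
Qed.

Lemma cayley_inj (z w : C) : Cmod z < 1 -> Cmod w < 1 -> cayley z = cayley w -> z = w.
Proof.
intros Hz Hw E. assert (N1 := one_minus_nz z Hz). assert (N2 := one_minus_nz w Hw).
apply Csub_eq_0.
assert (T : RtoC 2 <> RtoC 0) by (apply RtoC_neq_0; lra).
replace (z - w)%C with ((cayley z - cayley w) * ((1 - z) * (1 - w)) / 2)%C.
2:{ rewrite cayley_sub by trivial. field. auto. }
rewrite E. unfold Cdiv. ring.
Qed.

(** The pseudo-hyperbolic distance of the half-plane is [|u - v| / |u + conj v|]. *)
Lemma schwarz_pick_cayley (f : C -> C) : maps_disc_into_disc f ->
  (forall z, Cmod z < 1 -> cdiff f z) ->
  forall z w, Cmod z < 1 -> Cmod w < 1 ->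
  Cmod (cayley (f z) - cayley (f w)) * Cmod (cayley z + Cconj (cayley w))
   <= Cmod (cayley z - cayley w) * Cmod (cayley (f z) + Cconj (cayley (f w))).
Proof.
intros Hf Hd z w Hz Hw. assert (S := schwarz_pick f Hf Hd z w Hz Hw).
assert (Hfz := Hf z Hz). assert (Hfw := Hf w Hw). unfold unit_disc in *.
assert (N1 := one_minus_nz z Hz). assert (N2 := one_minus_nz w Hw).
assert (N3 := one_minus_nz _ Hfz). assert (N4 := one_minus_nz _ Hfw).
assert (Nc : forall x, (1 - x <> 0)%C -> Cconj (1 - x) <> 0%C).
{ intros x Hx. apply Cmod_gt_0. rewrite Cmod_conj. now apply Cmod_gt_0. }
rewrite !cayley_sub, !cayley_add_conj by trivial.
rewrite !Cmod_div by (apply Cmult_neq_0; auto).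
rewrite !Cmod_mult, !Cmod_conj, Cmod_R, Rabs_pos_eq by lra.
apply Cmod_gt_0 in N1. apply Cmod_gt_0 in N2. apply Cmod_gt_0 in N3. apply Cmod_gt_0 in N4.
set (x1 := Cmod (1 - z)) in *. set (x2 := Cmod (1 - w)) in *.
set (x3 := Cmod (1 - f z)) in *. set (x4 := Cmod (1 - f w)) in *.
set (A := Cmod (f z - f w)) in *. set (B := Cmod (z - w)) in *.
set (X := Cmod (1 - Cconj (f w) * f z)) in *. set (Y := Cmod (1 - Cconj w * z)) in *.
assert (K : 0 < 4 / (x1 * x2 * x3 * x4)).
{ apply Rdiv_lt_0_compat; [lra|]. repeat apply Rmult_lt_0_compat; trivial. }
replace (2 * A / (x3 * x4) * (2 * Y / (x1 * x2))) with (4 / (x1 * x2 * x3 * x4) * (A * Y)) by (field; lra).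
replace (2 * B / (x1 * x2) * (2 * X / (x3 * x4))) with (4 / (x1 * x2 * x3 * x4) * (B * X)) by (field; lra).
apply Rmult_le_compat_l; lra.
Qed.

(** The half-plane contains points with arbitrarily large imaginary part, large real
    part, and small real part; these force in turn [la] to be real, [la >= 0], and
    [Re ta >= 0]. *)
Lemma half_plane_affine (la ta : C) :
  (forall w, 0 < Re w -> 0 < Re (la * w + ta)) ->
  exists l : R, 0 <= l /\ la = RtoC l /\ 0 <= Re ta.
Proof.
intros H. destruct la as [lx ly], ta as [tx ty].
assert (H' : forall x y, 0 < x -> 0 < lx * x - ly * y + tx).
{ intros x y Hx. exact (H (x, y) Hx). }
assert (Hly : ly = 0).
{ destruct (Req_dec ly 0) as [|n]; trivial. exfalso.
  specialize (H' 1 ((lx + tx) / ly) Rlt_0_1).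
  replace (lx * 1 - ly * ((lx + tx) / ly) + tx) with 0 in H' by (field; trivial). lra. }
subst ly.
assert (Hlx : 0 <= lx).
{ destruct (Rle_lt_dec 0 lx) as [|n]; trivial. exfalso.
  assert (P := Rabs_pos tx). assert (P2 := RRle_abs tx).
  specialize (H' ((Rabs tx + 1) / - lx) 0 ltac:(apply Rdiv_lt_0_compat; lra)).
  replace (lx * ((Rabs tx + 1) / - lx)) with (- (Rabs tx + 1)) in H' by (field; lra). lra. }
exists lx. split; trivial. split; trivial. simpl.
destruct (Rle_lt_dec 0 tx) as [|n]; trivial. exfalso.
specialize (H' (- tx / (2 * (lx + 1))) 0 ltac:(apply Rdiv_lt_0_compat; lra)).
assert (lx * (- tx / (2 * (lx + 1))) <= - tx / 2); [|lra].
replace (lx * (- tx / (2 * (lx + 1)))) with ((lx / (lx + 1)) * (- tx / 2)) by (field; lra).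
assert (lx / (lx + 1) <= 1) by (apply Rle_div_l; lra). nra.
Qed.

Lemma le_of_le_add_eps (x y K : R) : 0 <= K -> (forall eps, 0 < eps -> x <= y + K * eps) -> x <= y.
Proof.
intros HK H. apply Rle_plus_epsilon. intros eps He.
specialize (H (eps / (K + 1)) ltac:(apply Rdiv_lt_0_compat; lra)).
assert (K * (eps / (K + 1)) <= eps); [|lra].
replace (K * (eps / (K + 1))) with (K / (K + 1) * eps) by (field; lra).
assert (K / (K + 1) <= 1) by (apply Rle_div_l; lra). nra.
Qed.

Lemma le_0_of_bounded_multiples (x K : R) : (forall n : nat, INR n * x <= K) -> x <= 0.
Proof.
intros H. destruct (Rle_lt_dec x 0) as [|Hx]; trivial. exfalso.
destruct (INR_unbounded (K / x)) as [n Hn]. specialize (H n).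
apply Rlt_div_l in Hn; lra.
Qed.

Lemma Cmod_add_real (X : C) (s t : R) : Cmod (X + RtoC s) <= Cmod (X + RtoC t) + Rabs (s - t).
Proof.
replace (X + RtoC s)%C with ((X + RtoC t) + RtoC (s - t))%C by (rewrite RtoC_minus; ring).
rewrite <- Cmod_R. apply Cmod_triangle.
Qed.

(** The factors [|X + 2 be n|] are the denominators of the distance of the half-plane
    [Re u > - be n]; as [be n] tends to [b], both inequalities pass to the limit. *)
Lemma interlaced_limit_finite (A A' : R) (X X' : C) (be : nat -> R) (b : R) :
  0 <= A -> 0 <= A' ->
  (forall n, A' * Cmod (X + RtoC (2 * be n)) <= A * Cmod (X' + RtoC (2 * be n))) ->
  (forall n, A * Cmod (X' + RtoC (2 * be n)) <= A' * Cmod (X + RtoC (2 * be (S n)))) ->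
  (forall eps, 0 < eps -> exists N, forall n, (N <= n)%nat -> Rabs (be n - b) <= eps) ->
  A' * Cmod (X + RtoC (2 * b)) = A * Cmod (X' + RtoC (2 * b)).
Proof.
intros HA HA' H1 H2 Hlim.
assert (E : forall n eps, Rabs (be n - b) <= eps -> forall Z,
  Cmod (Z + RtoC (2 * b)) <= Cmod (Z + RtoC (2 * be n)) + 2 * eps /\
  Cmod (Z + RtoC (2 * be n)) <= Cmod (Z + RtoC (2 * b)) + 2 * eps).
{ intros n eps He Z.
  assert (T1 := Cmod_add_real Z (2 * b) (2 * be n)). assert (T2 := Cmod_add_real Z (2 * be n) (2 * b)).
  replace (2 * b - 2 * be n) with (2 * - (be n - b)) in T1 by ring.
  replace (2 * be n - 2 * b) with (2 * (be n - b)) in T2 by ring.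
  rewrite Rabs_mult, Rabs_Ropp, (Rabs_pos_eq 2) in T1 by lra.
  rewrite Rabs_mult, (Rabs_pos_eq 2) in T2 by lra. lra. }
apply Rle_antisym; apply le_of_le_add_eps with (K := 2 * A + 2 * A'); try lra;
  intros eps He; destruct (Hlim eps He) as [N HN].
- destruct (E N eps (HN N (le_n _)) X) as [E1 _]. destruct (E N eps (HN N (le_n _)) X') as [_ E2].
  specialize (H1 N). nra.
- destruct (E N eps (HN N (le_n _)) X') as [E1 _].
  destruct (E (S N) eps (HN (S N) (le_S _ _ (le_n _))) X) as [_ E2].
  specialize (H2 N). nra.
Qed.

(** The half-planes increase to the whole plane.  The second factors differ from
    [2 n t] by a bounded amount, so comparing the terms linear in [n] compares [A]
    with [A']. *)
Lemma interlaced_limit_infinite (A A' : R) (X X' : C) (t : R) :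
  0 <= A -> 0 <= A' -> 0 < t ->
  (forall n, A' * Cmod (X + RtoC (2 * (INR n * t))) <= A * Cmod (X' + RtoC (2 * (INR n * t)))) ->
  (forall n, A * Cmod (X' + RtoC (2 * (INR n * t))) <= A' * Cmod (X + RtoC (2 * (INR (S n) * t)))) ->
  A' = A.
Proof.
intros HA HA' Ht H1 H2.
assert (E : forall n Z, 2 * (INR n * t) - Cmod Z <= Cmod (Z + RtoC (2 * (INR n * t)))
    <= 2 * (INR n * t) + Cmod Z).
{ intros n Z. assert (P := pos_INR n). assert (P1 : 0 <= 2 * (INR n * t)) by nra.
  assert (T1 := Cmod_triangle Z (RtoC (2 * (INR n * t)))).
  assert (T2 := Cmod_sub_ge (RtoC (2 * (INR n * t))) (- Z)).
  replace (RtoC (2 * (INR n * t)) - - Z)%C with (Z + RtoC (2 * (INR n * t)))%C in T2 by ring.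
  rewrite Cmod_opp, Cmod_R, Rabs_pos_eq in T2 by trivial. rewrite Cmod_R, Rabs_pos_eq in T1 by trivial.
  lra. }
apply Rle_antisym.
- assert ((A' - A) * t <= 0); [|nra].
  apply le_0_of_bounded_multiples with (K := (A * Cmod X' + A' * Cmod X) / 2). intros n.
  destruct (E n X) as [E1 _]. destruct (E n X') as [_ E2]. specialize (H1 n).
  set (s := INR n * t) in *. replace (INR n * ((A' - A) * t)) with ((A' - A) * s) by (unfold s; ring). nra.
- assert ((A - A') * t <= 0); [|nra].
  apply le_0_of_bounded_multiples with (K := (A * Cmod X' + A' * (Cmod X + 2 * t)) / 2). intros n.
  destruct (E n X') as [E1 _]. destruct (E (S n) X) as [_ E2]. specialize (H2 n).
  rewrite S_INR in E2, H2.
  replace ((INR n + 1) * t) with (INR n * t + t) in E2, H2 by ring.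
  set (s := INR n * t) in *. replace (INR n * ((A - A') * t)) with ((A - A') * s) by (unfold s; ring). nra.
Qed.

(** * Commuting factors of a Moebius map: boundary fixed points *)

Lemma zero_in_disc : Cmod 0 < 1.
Proof. rewrite Cmod_0. lra. Qed.

Lemma Cmod_cayley_sub (z w : C) : Cmod z < 1 -> Cmod w < 1 ->
  Cmod (cayley z - cayley w) = 2 * Cmod (z - w) / (Cmod (1 - z) * Cmod (1 - w)).
Proof.
intros Hz Hw. rewrite cayley_sub by trivial.
rewrite Cmod_div by (apply Cmult_neq_0; now apply one_minus_nz).
now rewrite !Cmod_mult, Cmod_R, Rabs_pos_eq by lra.
Qed.

Lemma cayley_plus_nz (z k : C) : Cmod z < 1 -> 0 <= Re k -> (cayley z + k <> 0)%C.
Proof.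
intros Hz Hk E. assert (P := Re_cayley z Hz).
apply (f_equal fst) in E. unfold Re in *. simpl fst in *. simpl in E, P. lra.
Qed.

Lemma cayley_plus_clear (z k : C) : Cmod z < 1 ->
  ((1 + k) + (1 - k) * z = (1 - z) * (cayley z + k))%C.
Proof. intros Hz. unfold cayley. field. now apply one_minus_nz. Qed.

Lemma mobius_rigidity_half_plane (f : C -> C) (be : R) : maps_disc_into_disc f ->
  (forall z, Cmod z < 1 -> cdiff f z) -> 0 <= be ->
  (forall z, Cmod z < 1 ->
    Cmod (cayley (f z) - cayley (f 0)) * Cmod (cayley z + Cconj (cayley 0) + RtoC (2 * be)) =
    Cmod (cayley z - cayley 0) * Cmod (cayley (f z) + Cconj (cayley (f 0)) + RtoC (2 * be))) ->
  mobius_on_disc f.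
Proof.
intros Hf Hd Hbe H.
assert (H0 := zero_in_disc).
set (q := f 0) in *. assert (Hq : Cmod q < 1) by now apply Hf.
assert (Nq := one_minus_nz q Hq).
set (k0 := (Cconj (cayley 0) + RtoC (2 * be))%C). set (k := (Cconj (cayley q) + RtoC (2 * be))%C).
assert (Rk : forall w, Cmod w < 1 -> 0 <= Re (Cconj (cayley w) + RtoC (2 * be))).
{ intros w Hw. assert (P := Re_cayley w Hw). unfold Re in *. simpl in *. lra. }
assert (Eb : forall z, Cmod z < 1 -> ((1 + k0) / (1 - q) + (1 - k0) / (1 - q) * z
   = (1 - z) * (cayley z + k0) / (1 - q))%C).
{ intros z Hz. rewrite <- cayley_plus_clear by trivial. field. trivial. }
apply (mobius_rigidity f ((1 + k0) / (1 - q)) ((1 - k0) / (1 - q)) (1 + k) (1 - k)); trivial.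
- intros z Hz. rewrite Eb by trivial.
  assert (N : ((1 - z) * (cayley z + k0) <> 0)%C).
  { apply Cmult_neq_0. now apply one_minus_nz. apply cayley_plus_nz; trivial. now apply Rk. }
  intros Z. apply N. replace ((1 - z) * (cayley z + k0))%C with
    ((1 - z) * (cayley z + k0) / (1 - q) * (1 - q))%C by (field; trivial). rewrite Z. ring.
- intros z Hz. assert (Hfz := Hf z Hz). rewrite cayley_plus_clear by trivial.
  apply Cmult_neq_0. now apply one_minus_nz. apply cayley_plus_nz; trivial. now apply Rk.
- intros z Hz. assert (Hfz := Hf z Hz). rewrite Eb, cayley_plus_clear by trivial.
  specialize (H z Hz). rewrite !Cmod_cayley_sub in H by trivial.
  rewrite <- !Cplus_assoc in H. fold k0 k in H.
  replace (z - 0)%C with z in H by ring. replace (1 - 0)%C with (RtoC 1) in H by ring. rewrite Cmod_1 in H.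
  rewrite Cmod_div, !Cmod_mult by trivial. fold q.
  assert (N1 := proj1 (Cmod_gt_0 _) (one_minus_nz z Hz)). apply Cmod_gt_0 in Nq.
  assert (N2 := proj1 (Cmod_gt_0 _) (one_minus_nz _ Hfz)).
  set (x := Cmod (1 - z)) in *. set (y := Cmod (1 - f z)) in *. set (w := Cmod (1 - q)) in *.
  set (X := Cmod (cayley z + k0)) in *. set (Y := Cmod (cayley (f z) + k)) in *.
  set (A := Cmod (f z - q)) in *. set (B := Cmod z) in *.
  replace (A * (x * X / w)) with ((2 * A / (y * w) * X) * (x * y / 2)) by (field; lra).
  rewrite H. field. lra.
Qed.

Lemma mobius_rigidity_plane (f : C -> C) : maps_disc_into_disc f ->
  (forall z, Cmod z < 1 -> cdiff f z) ->
  (forall z, Cmod z < 1 -> Cmod (cayley (f z) - cayley (f 0)) = Cmod (cayley z - cayley 0)) ->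
  mobius_on_disc f.
Proof.
intros Hf Hd H.
assert (H0 := zero_in_disc).
set (q := f 0) in *. assert (Hq : Cmod q < 1) by now apply Hf.
assert (Nq := one_minus_nz q Hq).
assert (Eb : forall z, (1 / (1 - q) + - (1 / (1 - q)) * z = (1 - z) / (1 - q))%C).
{ intros z. field. trivial. }
assert (Ec : forall z, (1 + -(1) * z = 1 - z)%C) by (intros; ring).
apply (mobius_rigidity f (1 / (1 - q)) (- (1 / (1 - q))) 1 (- (1))); trivial.
- intros z Hz. rewrite Eb. intros Z. apply (one_minus_nz z Hz).
  replace (1 - z)%C with ((1 - z) / (1 - q) * (1 - q))%C by (field; trivial). rewrite Z. ring.
- intros z Hz. rewrite Ec. now apply one_minus_nz, Hf.
- intros z Hz. assert (Hfz := Hf z Hz). rewrite Eb, Ec.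
  specialize (H z Hz). rewrite !Cmod_cayley_sub in H by trivial.
  replace (z - 0)%C with z in H by ring. replace (1 - 0)%C with (RtoC 1) in H by ring. rewrite Cmod_1 in H.
  rewrite Cmod_div by trivial. fold q.
  assert (N1 := proj1 (Cmod_gt_0 _) (one_minus_nz z Hz)). apply Cmod_gt_0 in Nq.
  assert (N2 := proj1 (Cmod_gt_0 _) (one_minus_nz _ Hfz)).
  set (x := Cmod (1 - z)) in *. set (y := Cmod (1 - f z)) in *. set (w := Cmod (1 - q)) in *.
  set (A := Cmod (f z - q)) in *. set (B := Cmod z) in *.
  replace (A * (x / w)) with ((2 * A / (y * w)) * (x * y / 2)) by (field; lra).
  rewrite H. field. lra.
Qed.

(** If [m] is [w |-> l w + ta] with [Re ta = t] in the half-plane coordinate, then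
    [m ^ (- n)] maps the half-plane onto [Re w > - drift l t n]. *)
Fixpoint drift (l t : R) (n : nat) : R :=
  match n with O => 0 | S k => drift l t k + t / l ^ S k end.

Lemma drift_1 t n : drift 1 t n = INR n * t.
Proof.
induction n as [|n IH]; [simpl; ring|]. cbn [drift]. rewrite IH, pow1, S_INR. field.
Qed.

Lemma drift_0 l n : drift l 0 n = 0.
Proof. induction n as [|n IH]; [reflexivity|]. cbn [drift]. rewrite IH. unfold Rdiv. ring. Qed.

Lemma drift_geom l t n : 1 < l -> drift l t n = t / (l - 1) - t / (l - 1) * (/ l) ^ n.
Proof.
intros Hl. induction n as [|n IH]; [simpl; ring|]. cbn [drift]. rewrite IH, !pow_inv. simpl. field.
assert (l ^ n <> 0) by (apply pow_nonzero; lra). lra.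
Qed.

Lemma iter_cayley m (l : R) (ta : C) n : 0 < l -> (forall z, Cmod z < 1 -> Cmod (m z) < 1) ->
  (forall z, Cmod z < 1 -> cayley (m z) = (l * cayley z + ta)%C) ->
  exists T, Re T = l ^ n * drift l (Re ta) n /\
   forall z, Cmod z < 1 -> cayley (Nat.iter n m z) = (RtoC (l ^ n) * cayley z + T)%C.
Proof.
intros Hl Hm H. induction n as [|n [T [IH1 IH2]]].
- exists 0%C. split; [simpl; ring|]. intros z Hz. simpl. ring.
- exists (l * T + ta)%C. split.
  + replace (Re (l * T + ta)) with (l * Re T + Re ta) by (unfold Re; simpl; ring).
    rewrite IH1. cbn [drift]. simpl. field. split; [apply pow_nonzero|]; lra.
  + intros z Hz. simpl Nat.iter. rewrite H by now apply iter_disc. rewrite IH2 by trivial.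
    simpl pow. rewrite RtoC_mult. ring.
Qed.

Lemma cayley_iterate_add m (l : R) (ta : C) n : 0 < l -> (forall z, Cmod z < 1 -> Cmod (m z) < 1) ->
  (forall z, Cmod z < 1 -> cayley (m z) = (l * cayley z + ta)%C) ->
  forall z w, Cmod z < 1 -> Cmod w < 1 ->
  Cmod (cayley (Nat.iter n m z) - cayley (Nat.iter n m w)) = l ^ n * Cmod (cayley z - cayley w) /\
  Cmod (cayley (Nat.iter n m z) + Cconj (cayley (Nat.iter n m w))) =
    l ^ n * Cmod (cayley z + Cconj (cayley w) + RtoC (2 * drift l (Re ta) n)).
Proof.
intros Hl Hm H z w Hz Hw. destruct (iter_cayley m l ta n Hl Hm H) as [T [T1 T2]].
assert (P : 0 < l ^ n) by now apply pow_lt.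
assert (E : forall x, l ^ n * Cmod x = Cmod (RtoC (l ^ n) * x)).
{ intros x. rewrite Cmod_mult, Cmod_R, Rabs_pos_eq; lra. }
rewrite !E, !T2 by trivial. split; f_equal; [ring|].
set (r := l ^ n) in *. set (s := drift l (Re ta) n) in *.
destruct T as [x y]. unfold Re in T1. simpl in T1. subst x.
destruct (cayley z), (cayley w). apply injective_projections; simpl; ring.
Qed.

(** Schwarz-Pick for [f] at the [n]-th iterates of [z] and [w], and for [g] at their
    images under [f]; [g] takes these to the iterates of order [n + 1], because
    [g o f = m].  The powers of [l] cancel. *)
Lemma interlaced f g m (l : R) (ta : C) : mobius_factorization f g m -> 0 < l ->
  (forall z, Cmod z < 1 -> cayley (m z) = (l * cayley z + ta)%C) ->
  forall z w n, Cmod z < 1 -> Cmod w < 1 ->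
  let X := (cayley z + Cconj (cayley w))%C in
  let X' := (cayley (f z) + Cconj (cayley (f w)))%C in
  let A := Cmod (cayley z - cayley w) in
  let A' := Cmod (cayley (f z) - cayley (f w)) in
  A' * Cmod (X + RtoC (2 * drift l (Re ta) n)) <= A * Cmod (X' + RtoC (2 * drift l (Re ta) n)) /\
  A * Cmod (X' + RtoC (2 * drift l (Re ta) n)) <= A' * Cmod (X + RtoC (2 * drift l (Re ta) (S n))).
Proof.
intros H Hl Ha z w n Hz Hw X X' A A'.
assert (Hf := fact_f_disc _ _ _ H). assert (Hg := fact_g_disc _ _ _ H).
assert (Hm := fact_m_disc _ _ _ H : forall z, Cmod z < 1 -> Cmod (m z) < 1).
assert (P : 0 < l ^ n) by now apply pow_lt.
assert (Hzn := iter_disc m n z Hm Hz). assert (Hwn := iter_disc m n w Hm Hw).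
assert (Hfz := Hf z Hz). assert (Hfw := Hf w Hw).
assert (Hfzn := iter_disc m n _ Hm Hfz). assert (Hfwn := iter_disc m n _ Hm Hfw).
assert (C := fun u Hu => iter_commute f m n u Hm (fun v Hv => fact_commute _ _ _ v H Hv) Hu).
destruct (cayley_iterate_add m l ta n Hl Hm Ha z w Hz Hw) as [Q1 Q2].
destruct (cayley_iterate_add m l ta n Hl Hm Ha _ _ Hfz Hfw) as [Q3 Q4].
split.
- assert (S := schwarz_pick_cayley f Hf (fact_f_diff _ _ _ H) _ _ Hzn Hwn).
  rewrite !C, Q1, Q2, Q3, Q4 in S by trivial. fold X X' A A' in S.
  apply Rmult_le_reg_l with (l ^ n * l ^ n); [nra|]. nra.
- assert (S := schwarz_pick_cayley g Hg (fact_g_diff _ _ _ H) _ _ Hfzn Hfwn).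
  rewrite <- !C, !(fact_gf _ _ _ H), !C in S by trivial.
  change (m (Nat.iter n m z)) with (Nat.iter (Datatypes.S n) m z) in S.
  change (m (Nat.iter n m w)) with (Nat.iter (Datatypes.S n) m w) in S.
  destruct (cayley_iterate_add m l ta (Datatypes.S n) Hl Hm Ha z w Hz Hw) as [Q5 Q6].
  rewrite Q3, Q4, Q5, Q6 in S. fold X X' A A' in S.
  apply Rmult_le_reg_l with (l ^ Datatypes.S n * l ^ n); [|nra].
  apply Rmult_lt_0_compat; trivial. now apply pow_lt.
Qed.

(** In the half-plane coordinate [m] is [w |-> l w + ta] with [l > 0] and
    [Re ta >= 0].  If [Re ta > 0] and [l < 1], then [ta / (1 - l)] is an interior fixed
    point.  Otherwise the half-planes [m ^ (- n) (Re w > 0)] are constant, for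
    [Re ta = 0], or increase to a plane, for [l = 1], or to a half-plane, for [l > 1],
    and [f] is an isometry of the limit. *)
Lemma mobius_root_fixing_one f g m (a b c d : C) : mobius_factorization f g m ->
  (forall z, Cmod z < 1 -> (c * z + d <> 0)%C /\ (m z * (c * z + d) = a * z + b)%C) ->
  (a + b = c + d)%C -> mobius_on_disc f.
Proof.
intros H Hm E1.
assert (Hf := fact_f_disc _ _ _ H). assert (Hd := fact_f_diff _ _ _ H).
assert (Hmd := fact_m_disc _ _ _ H : forall z, Cmod z < 1 -> Cmod (m z) < 1).
assert (H0 := zero_in_disc).
assert (Ea : a = (c + d - b)%C) by (rewrite <- E1; ring).
assert (T : RtoC 2 <> RtoC 0) by (apply RtoC_neq_0; lra).
assert (Ndb : (d - b <> 0)%C).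
{ intros Z. apply Csub_eq_0 in Z. destruct (Hm 0 H0) as [N1 N2].
  apply (one_minus_nz _ (Hmd 0 H0)).
  replace (c * 0 + d)%C with d in * by ring.
  replace (1 - m 0)%C with ((d - m 0 * d) / d)%C by (field; trivial).
  rewrite N2, Z. unfold Cdiv. ring. }
(* The coefficients of [m] in the half-plane coordinate. *)
set (la := ((c + d) / (d - b))%C). set (ta := ((b + d - a - c) / (2 * (d - b)))%C).
assert (Haff : forall z, Cmod z < 1 -> cayley (m z) = (la * cayley z + ta)%C).
{ intros z Hz. destruct (Hm z Hz) as [N1 N2]. assert (N3 := one_minus_nz z Hz).
  assert (N4 := one_minus_nz _ (Hmd z Hz)).
  unfold cayley, la, ta.
  assert (Ez : m z = ((a * z + b) / (c * z + d))%C) by (rewrite <- N2; field; trivial).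
  rewrite Ez in N4 |- *. rewrite Ea in *. field. repeat split; trivial.
  replace (c * z + d - ((c + d - b) * z + b))%C with ((d - b) * (1 - z))%C by ring.
  now apply Cmult_neq_0. }
destruct (half_plane_affine la ta) as [l [Hl0 [Hl Hta]]].
{ intros w Hw. destruct (cayley_surj w Hw) as [z [Hz <-]]. rewrite <- Haff by trivial.
  now apply Re_cayley, Hmd. }
rewrite Hl in Haff. clearbody ta.
assert (Hlpos : 0 < l).
{ destruct Hl0 as [|Hl0]; trivial. exfalso. subst l.
  assert (H2 : Cmod (RtoC (1 / 2)) < 1) by (rewrite Cmod_R, Rabs_pos_eq; lra).
  assert (Q : RtoC 0 = RtoC (1 / 2)).
  { apply (fact_inj _ _ _ H); trivial. apply cayley_inj; auto. rewrite !Haff by trivial. ring. }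
  injection Q. lra. }
assert (I := interlaced f g m l ta H Hlpos Haff).
set (t := Re ta) in *.
destruct (Req_dec t 0) as [Ht|Ht].
{ apply (mobius_rigidity_half_plane f 0); trivial; [lra|]. intros z Hz.
  apply interlaced_limit_finite with (be := drift l t); try apply Cmod_ge_0.
  - intros n. apply (I z 0%C n Hz H0).
  - intros n. apply (I z 0%C n Hz H0).
  - intros eps He. exists 0%nat. intros n _. rewrite Ht, drift_0, Rminus_0_r, Rabs_R0. lra. }
destruct (Rtotal_order l 1) as [L|[L|L]].
- (* interior fixed point *)
  assert (N1 : RtoC (1 - l) <> 0%C) by (apply RtoC_neq_0; lra).
  destruct (cayley_surj (ta / RtoC (1 - l))) as [p [Hp Ep]].
  { replace (ta / RtoC (1 - l))%C with (RtoC (/ (1 - l)) * ta)%C by (rewrite RtoC_inv by lra; field; trivial).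
    replace (Re (RtoC (/ (1 - l)) * ta)) with (/ (1 - l) * t) by (unfold t, Re; simpl; ring).
    apply Rmult_lt_0_compat; [apply Rinv_0_lt_compat|]; lra. }
  apply (mobius_root_fixing_interior f g m p); trivial.
  + exists a, b, c, d. exact Hm.
  + apply cayley_inj; auto. rewrite Haff, Ep by trivial.
    rewrite RtoC_minus in *. field. trivial.
- subst l. apply mobius_rigidity_plane; trivial. intros z Hz.
  apply interlaced_limit_infinite with (X := (cayley z + Cconj (cayley 0))%C)
   (X' := (cayley (f z) + Cconj (cayley (f 0)))%C) (t := t); try apply Cmod_ge_0; [lra| |].
  + intros n. rewrite <- drift_1. apply (I z 0%C n Hz H0).
  + intros n. rewrite <- !drift_1. apply (I z 0%C n Hz H0).
- assert (Pb : 0 <= t / (l - 1)) by (apply Rdiv_le_0_compat; lra).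
  apply (mobius_rigidity_half_plane f (t / (l - 1))); trivial. intros z Hz.
  apply interlaced_limit_finite with (be := drift l t); try apply Cmod_ge_0.
  + intros n. apply (I z 0%C n Hz H0).
  + intros n. apply (I z 0%C n Hz H0).
  + intros eps He. set (B := t / (l - 1)) in *.
    assert (Hi : 0 < / l < 1).
    { split; [apply Rinv_0_lt_compat; lra|]. rewrite <- Rinv_1. apply Rinv_lt_contravar; lra. }
    destruct (pow_lt_1_zero (/ l)) with (y := eps / (B + 1)) as [N HN].
    rewrite Rabs_pos_eq; lra. apply Rdiv_lt_0_compat; lra.
    exists N. intros n Hn. specialize (HN n Hn). rewrite drift_geom by trivial. fold B.
    replace (B - B * (/ l) ^ n - B) with (- (B * (/ l) ^ n)) by ring.
    rewrite Rabs_pos_eq in HN by (apply pow_le; lra).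
    assert (0 <= (/ l) ^ n) by (apply pow_le; lra).
    rewrite Rabs_Ropp, Rabs_pos_eq by nra.
    apply Rlt_div_r in HN; [|lra]. nra.
Qed.

Lemma mobius_root_fixing_boundary f g m (a b c d p : C) : mobius_factorization f g m ->
  (forall z, Cmod z < 1 -> (c * z + d <> 0)%C /\ (m z * (c * z + d) = a * z + b)%C) ->
  Cmod p = 1 -> (a * p + b = p * (c * p + d))%C -> mobius_on_disc f.
Proof.
intros H Hm Hp E. assert (A := aut_rotation p Hp). assert (Q := Cmod1_conj p Hp).
apply (mobius_of_conjugate _ _ _ A). apply (fact_f_disc _ _ _ H).
apply (mobius_root_fixing_one _ _ _ a (Cconj p * b) (c * p) d (fact_conjugate _ _ _ _ _ A H)).
- intros z Hz. destruct (Hm (p * z)%C) as [N1 N2]. rewrite Cmod_mult, Hp. lra.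
  replace (c * p * z + d)%C with (c * (p * z) + d)%C by ring. split; trivial.
  rewrite <- Cmult_assoc, N2.
  replace (Cconj p * (a * (p * z) + b))%C with ((Cconj p * p) * (a * z) + Cconj p * b)%C by ring.
  rewrite Q. ring.
- replace (a + Cconj p * b)%C with ((1 - Cconj p * p) * a + Cconj p * (a * p + b))%C by ring.
  rewrite E, Q.
  replace (Cconj p * (p * (c * p + d)))%C with ((Cconj p * p) * (c * p + d))%C by ring.
  rewrite Q. ring.
Qed.

(** For suitable [z] of modulus [r], the numbers [al z] and [be] point in the same
    direction, so their moduli add up. *)
Lemma affine_self_map_bound (m : C -> C) (al be : C) : (forall z, Cmod z < 1 -> Cmod (m z) < 1) ->
  (forall z, Cmod z < 1 -> m z = (al * z + be)%C) -> Cmod al + Cmod be <= 1.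
Proof.
intros Hm H.
destruct (unit_direction al) as [u [Hu Eu]]. destruct (unit_direction be) as [v [Hv Ev]].
assert (Qv := Cmod1_conj v Hv).
assert (Hr : forall r, 0 < r < 1 -> r * Cmod al + Cmod be <= 1).
{ intros r Hr.
  set (z := (r * (u * Cconj v))%C).
  assert (Hz : Cmod z < 1).
  { unfold z. rewrite !Cmod_mult, Cmod_conj, Hu, Hv, Cmod_R, Rabs_pos_eq; lra. }
  assert (E : (al * z + be = - (RtoC (r * Cmod al + Cmod be) * Cconj v))%C).
  { replace (al * z + be)%C with (al * z + (be * v) * Cconj v + be * (1 - Cconj v * v))%C by ring.
    rewrite Qv, Ev. unfold z.
    replace (al * (r * (u * Cconj v)))%C with (r * (al * u) * Cconj v)%C by ring.
    rewrite Eu, RtoC_plus, RtoC_mult. ring. }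
  assert (B := Hm z Hz). rewrite H, E, Cmod_opp, Cmod_mult, Cmod_conj, Hv, Cmod_R in B by trivial.
  assert (T := RRle_abs (r * Cmod al + Cmod be)). lra. }
apply le_1_of_scaled. intros r Hr1. specialize (Hr r Hr1).
assert (P := Cmod_ge_0 be). nra.
Qed.

(** The fixed point [be / (1 - al)] has modulus at most [1], because
    [|be| <= 1 - |al| <= |1 - al|]. *)
Lemma mobius_root_affine f g m (a b d : C) : mobius_factorization f g m -> d <> 0%C ->
  (forall z, Cmod z < 1 -> (m z * d = a * z + b)%C) -> mobius_on_disc f.
Proof.
intros H Hd0 Hm.
assert (Hmd := fact_m_disc _ _ _ H : forall z, Cmod z < 1 -> Cmod (m z) < 1).
set (al := (a / d)%C). set (be := (b / d)%C).
assert (Haff : forall z, Cmod z < 1 -> m z = (al * z + be)%C).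
{ intros z Hz. replace (m z) with (m z * d / d)%C by (field; trivial). rewrite (Hm z Hz). unfold al, be.
  field. trivial. }
assert (B := affine_self_map_bound m al be Hmd Haff).
assert (Hc : forall z, Cmod z < 1 -> (0 * z + 1 <> 0)%C /\ (m z * (0 * z + 1) = al * z + be)%C).
{ intros z Hz. replace (0 * z + 1)%C with (RtoC 1) by ring. split; [apply C1_nz|].
  rewrite <- Haff by trivial. ring. }
assert (Hmob : mobius_on_disc m) by (exists al, be, 0%C, 1%C; exact Hc).
assert (Pb := Cmod_ge_0 be).
destruct (Ceq_dec al 1) as [E|N].
- apply (mobius_root_fixing_origin f g m H Hmob). rewrite Haff by apply zero_in_disc.
  rewrite E, Cmod_1 in B. assert (Eb : be = 0%C) by (apply Cmod_eq_0; lra). rewrite Eb. ring.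
- assert (N1 : (1 - al <> 0)%C) by (intros Z; apply N; symmetry; now apply Csub_eq_0).
  set (q := (be / (1 - al))%C).
  assert (Eq : (al * q + be = q)%C) by (unfold q; field; trivial).
  assert (Hq : Cmod q <= 1).
  { unfold q. rewrite Cmod_div by trivial. apply Rle_div_l; [now apply Cmod_gt_0|].
    assert (T := Cmod_sub_ge 1 al). rewrite Cmod_1 in T. lra. }
  destruct Hq as [Hq|Hq].
  + apply (mobius_root_fixing_interior f g m q H Hmob Hq). rewrite Haff; trivial.
  + apply (mobius_root_fixing_boundary f g m al be 0 1 q H Hc Hq). rewrite Eq. ring.
Qed.

Lemma complex_sqrt (z : C) : exists s, (s * s = z)%C.
Proof.
destruct z as [x y].
set (r := Cmod (x, y)).
assert (Hr : r ^ 2 = x ^ 2 + y ^ 2) by (unfold r; rewrite Cmod2_alt; reflexivity).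
assert (Hx := Rabs_fst_le (x, y)). simpl fst in Hx. fold r in Hx.
assert (Hx1 := RRle_abs x). assert (Hx2 := RRle_abs (- x)). rewrite Rabs_Ropp in Hx2.
set (p := sqrt ((r + x) / 2)). set (q := sqrt ((r - x) / 2)).
assert (Ep : p * p = (r + x) / 2) by (apply sqrt_sqrt; lra).
assert (Eq : q * q = (r - x) / 2) by (apply sqrt_sqrt; lra).
assert (Epq : 2 * (p * q) = Rabs y).
{ unfold p, q. rewrite <- sqrt_mult by lra.
  replace ((r + x) / 2 * ((r - x) / 2)) with ((y / 2) ^ 2) by (simpl in *; lra).
  rewrite <- Rsqr_pow2, sqrt_Rsqr_abs. unfold Rdiv. rewrite Rabs_mult, (Rabs_pos_eq (/ 2)) by lra. field. }
destruct (Rle_lt_dec 0 y) as [Hy|Hy].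
- exists (p, q). rewrite Rabs_pos_eq in Epq by trivial. apply injective_projections; simpl; lra.
- exists (p, - q). rewrite Rabs_left in Epq by trivial. apply injective_projections; simpl; lra.
Qed.

Lemma quadratic_root (a b c : C) : a <> 0%C -> exists z, (a * z * z + b * z + c = 0)%C.
Proof.
intros Ha. destruct (complex_sqrt (b * b - 4 * a * c)) as [s Hs].
assert (T : RtoC 2 <> RtoC 0) by (apply RtoC_neq_0; lra).
exists ((s - b) / (2 * a))%C.
replace (a * ((s - b) / (2 * a)) * ((s - b) / (2 * a)) + b * ((s - b) / (2 * a)) + c)%C
 with ((s * s - (b * b - 4 * a * c)) / (4 * a))%C.
- rewrite Hs. unfold Cdiv. ring.
- assert (T4 : RtoC 4 <> RtoC 0) by (apply RtoC_neq_0; lra). field. auto.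
Qed.

(** The case distinction is on a root [p] of the fixed point equation.  If [|p| > 1],
    the automorphism that sends [p] to infinity, that is, [1 / conj p] to the origin,
    conjugates [m] to an affine map. *)
Lemma mobius_root f g m : mobius_factorization f g m -> mobius_on_disc m -> mobius_on_disc f.
Proof.
intros H Hmob. assert (Hmob' := Hmob). destruct Hmob' as [a [b [c [d Hm]]]].
assert (H0 := zero_in_disc).
assert (Hmd := fact_m_disc _ _ _ H : forall z, Cmod z < 1 -> Cmod (m z) < 1).
destruct (Ceq_dec c 0) as [->|Hc].
{ destruct (Hm 0 H0) as [N _]. apply (mobius_root_affine f g m a b d); trivial.
  - intros Z. apply N. rewrite Z. ring.
  - intros z Hz. destruct (Hm z Hz) as [_ E]. rewrite <- E. ring. }
destruct (quadratic_root c (d - a) (- b) Hc) as [p Ep].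
assert (E : (a * p + b = p * (c * p + d))%C).
{ symmetry. apply Csub_eq_0. rewrite <- Ep. ring. }
destruct (Rtotal_order (Cmod p) 1) as [Hp|[Hp|Hp]].
- apply (mobius_root_fixing_interior f g m p); trivial.
  destruct (Hm p Hp) as [N1 N2]. rewrite E in N2.
  replace (m p) with (m p * (c * p + d) / (c * p + d))%C by (field; trivial).
  rewrite N2. field. trivial.
- now apply (mobius_root_fixing_boundary f g m a b c d p).
- assert (p0 : p <> 0%C) by (apply Cmod_gt_0; lra).
  assert (cp0 : Cconj p <> 0%C) by (apply Cmod_gt_0; rewrite Cmod_conj; lra).
  set (s := (/ Cconj p)%C).
  assert (Hs : Cmod s < 1).
  { unfold s. rewrite Cmod_inv, Cmod_conj by trivial. rewrite <- Rinv_1. apply Rinv_lt_contravar; lra. }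
  assert (Esp : (Cconj s * p = 1)%C).
  { unfold s. rewrite Cinv_conj, Cconj_conj by trivial. field. trivial. }
  assert (Esc : (Cconj s = / p)%C).
  { replace (/ p)%C with (Cconj s * p * / p)%C by (rewrite Esp; field; trivial). field. trivial. }
  assert (A := aut_blaschke s Hs). assert (Hs' : Cmod (- s) < 1) by now rewrite Cmod_opp.
  apply (mobius_of_conjugate _ _ _ A). apply (fact_f_disc _ _ _ H).
  set (t := Cconj s) in *.
  assert (key : forall z, Cmod z < 1 ->
    (c * s + d - t * (a * s + b) <> 0 /\
    blaschke s (m (blaschke (- s) z)) * (c * s + d - t * (a * s + b)) =
     ((a + b * t) - s * (c + d * t)) * z + ((a * s + b) - s * (c * s + d)))%C).
  { intros z Hz.
    assert (He := blaschke_den (- s) z Hs' (Rlt_le _ _ Hz)). rewrite Copp_conj in He. fold t in He.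
    assert (Hy := Cmod_blaschke_lt (- s) z Hs' Hz).
    destruct (Hm _ Hy) as [N1 N2].
    assert (HM := Hmd _ Hy).
    assert (HD := blaschke_den s _ Hs (Rlt_le _ _ HM)). fold t in HD.
    set (M := m (blaschke (- s) z)) in *.
    assert (Ey : (blaschke (- s) z * (1 - - t * z) = z + s)%C).
    { unfold blaschke. rewrite Copp_conj. fold t. field. trivial. }
    set (y := blaschke (- s) z) in *. set (e := (1 - - t * z)%C) in *.
    assert (Dn : ((c * y + d) * e = c * (z + s) + d * e)%C) by (rewrite <- Ey; ring).
    assert (Nn : (M * ((c * y + d) * e) = a * (z + s) + b * e)%C).
    { rewrite Cmult_assoc, N2, <- Ey. ring. }
    assert (Hdn : ((c * y + d) * e <> 0)%C) by now apply Cmult_neq_0.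
    set (D := ((c * y + d) * e)%C) in *.
    (* The denominator of the conjugated map is constant: the coefficient of [z] is
       the fixed point equation at [p = 1 / t], up to the factor [t ^ 2]. *)
    assert (Ed : (c * s + d - t * (a * s + b) = D * (1 - t * M))%C).
    { replace (D * (1 - t * M))%C with (D - t * (M * D))%C by ring. rewrite Nn, Dn. unfold e.
      apply Csub_eq_0.
      replace (c * s + d - t * (a * s + b)
          - (c * (z + s) + d * (1 - - t * z) - t * (a * (z + s) + b * (1 - - t * z))))%C
        with (- (c + d * t - t * (a + b * t)) * z)%C by ring.
      replace (c + d * t - t * (a + b * t))%C with (t * t * (c * p * p + (d - a) * p + - b))%C.
      rewrite Ep. ring.
      rewrite Esc. field. trivial. }
    rewrite Ed. split; [now apply Cmult_neq_0|].
    unfold blaschke at 1. fold t.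
    replace ((M - s) / (1 - t * M) * (D * (1 - t * M)))%C with (M * D - s * D)%C by (field; trivial).
    rewrite Nn, Dn. unfold e. ring. }
  apply (mobius_root_affine _ _ _ ((a + b * t) - s * (c + d * t)) ((a * s + b) - s * (c * s + d))
    (c * s + d - t * (a * s + b)) (fact_conjugate _ _ _ _ _ A H)).
  + apply (key 0%C H0).
  + intros z Hz. apply key. trivial.
Qed.

(** * Linear fractional self-maps and the semigroup *)

Lemma mobius_of_linear_fractional f : linear_fractional_self_map f ->
  mobius_on_disc f /\
  (forall z w, Cmod z < 1 -> Cmod w < 1 -> f z = f w -> z = w).
Proof.
intros [[a [b [c [d [Hcd Hf]]]]] [[z0 [w0 [Hz0 [Hw0 Hne]]]] _]].
assert (Hden : forall z, Cmod z < 1 -> (c * z + d <> 0)%C).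
{ intros z Hz. apply Cmod_gt_0. assert (T := Cmod_sub_ge d (- (c * z))).
  replace (d - - (c * z))%C with (c * z + d)%C in T by ring. rewrite Cmod_opp, Cmod_mult in T.
  assert (P1 := Cmod_ge_0 c). assert (P2 := Cmod_ge_0 z). nra. }
assert (Hsub : forall z w, Cmod z < 1 -> Cmod w < 1 ->
  ((f z - f w) * ((c * z + d) * (c * w + d)) = (a * d - b * c) * (z - w))%C).
{ intros z w Hz Hw. rewrite !Hf by trivial. field. auto. }
split.
- exists a, b, c, d. intros z Hz. split; auto. rewrite Hf by trivial. field. auto.
- intros z w Hz Hw E. assert (S := Hsub z w Hz Hw). rewrite E in S.
  assert (Z : ((a * d - b * c) * (z - w) = 0)%C) by (rewrite <- S; ring).
  apply Cmult_integral in Z. destruct Z as [Z|Z]; [|now apply Csub_eq_0].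
  exfalso. apply Hne. apply Csub_eq_0.
  assert (S0 := Hsub z0 w0 Hz0 Hw0). rewrite Z, Cmult_0_l in S0.
  apply Cmult_integral in S0. destruct S0 as [|S0]; trivial. exfalso. revert S0.
  apply Cmult_neq_0; auto.
Qed.

(** The pole must lie outside the closed disc.  It is not in the open disc; if it were
    on the circle, boundedness of [f] would make the numerator vanish there as well,
    and [f] would be constant. *)
Lemma linear_fractional_of_mobius f : maps_disc_into_disc f -> mobius_on_disc f ->
  (forall z w, Cmod z < 1 -> Cmod w < 1 -> f z = f w -> z = w) ->
  linear_fractional_self_map f.
Proof.
intros Hd [a [b [c [d Hf]]]] Hinj.
assert (H0 := zero_in_disc).
assert (H2 : Cmod (RtoC (1 / 2)) < 1) by (rewrite Cmod_R, Rabs_pos_eq; lra).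
assert (Hne : f 0 <> f (RtoC (1 / 2))).
{ intros E. apply Hinj in E; trivial. injection E. lra. }
split; [|split; trivial; exists 0%C, (RtoC (1 / 2)); auto].
exists a, b, c, d. split.
2:{ intros z Hz. destruct (Hf z Hz) as [N E]. rewrite <- E. field. trivial. }
destruct (Rtotal_order (Cmod c) (Cmod d)) as [|[E|L]]; trivial; exfalso.
- assert (d0 : d <> 0%C).
  { destruct (Hf 0 H0) as [N _]. intros Z. apply N. rewrite Z. ring. }
  assert (Pd := proj1 (Cmod_gt_0 d) d0).
  assert (c0 : c <> 0%C) by (apply Cmod_gt_0; lra).
  set (p := (- d / c)%C).
  assert (Hp : Cmod p = 1). { unfold p. rewrite Cmod_div, Cmod_opp, E by trivial. field. lra. }
  assert (Edp : d = (- (c * p))%C) by (unfold p; field; trivial).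
  assert (Z : Cmod (a * p + b) = 0).
  { apply Rle_antisym; [|apply Cmod_ge_0].
    apply le_of_le_add_eps with (K := Cmod d + Cmod a). { assert (P := Cmod_ge_0 a). lra. }
    intros eps He. rewrite Rplus_0_l.
    set (r := Rmin eps (1 / 2)).
    assert (r1 : r <= eps) by apply Rmin_l. assert (r2 : r <= 1 / 2) by apply Rmin_r.
    assert (r0 : 0 < r) by (apply Rmin_pos; lra).
    set (z := (RtoC (1 - r) * p)%C).
    assert (Hz : Cmod z < 1) by (unfold z; rewrite Cmod_mult, Hp, Cmod_R, Rabs_pos_eq; lra).
    destruct (Hf z Hz) as [_ Ez]. assert (Hfz := Hd z Hz). unfold unit_disc in Hfz.
    assert (Ed : (a * p + b = f z * (d * r) + a * p * r)%C).
    { replace (d * r)%C with (c * z + d)%C.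
      - rewrite Ez. unfold z. rewrite RtoC_minus. ring.
      - unfold z. rewrite RtoC_minus. rewrite Edp. ring. }
    rewrite Ed. eapply Rle_trans; [apply Cmod_triangle|].
    rewrite !Cmod_mult, Hp, Cmod_R, Rabs_pos_eq by lra.
    assert (P1 := Cmod_ge_0 a). assert (P2 := Cmod_ge_0 (f z)).
    assert (Cmod (f z) * (Cmod d * r) <= 1 * (Cmod d * eps)).
    { apply Rmult_le_compat; nra. }
    nra. }
  apply Cmod_eq_0 in Z. apply Hne.
  assert (Hc : forall z, Cmod z < 1 -> f z = (a / c)%C).
  { intros z Hz. destruct (Hf z Hz) as [N Ez].
    assert (Nz : (z - p <> 0)%C).
    { intros Q. apply N. rewrite Edp. apply Csub_eq_0 in Q. rewrite Q. ring. }
    replace (f z) with (f z * (c * z + d) / (c * (z - p)))%C.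
    2:{ rewrite Edp. field. auto. }
    rewrite Ez. replace b with (a * p + b - a * p)%C by ring. rewrite Z. field. auto. }
  now rewrite !Hc.
- assert (c0 : c <> 0%C) by (apply Cmod_gt_0; assert (P := Cmod_ge_0 d); lra).
  destruct (Hf (- d / c)%C) as [N _].
  + rewrite Cmod_div, Cmod_opp by trivial. apply Rlt_div_l; [now apply Cmod_gt_0|lra].
  + apply N. field. trivial.
Qed.

Lemma semigroup_multiple phi t0 : continuous_semigroup phi -> 0 <= t0 ->
  mobius_on_disc (phi t0) -> (forall z w, Cmod z < 1 -> Cmod w < 1 -> phi t0 z = phi t0 w -> z = w) ->
  forall n, mobius_on_disc (phi (INR n * t0)) /\
   (forall z w, Cmod z < 1 -> Cmod w < 1 -> phi (INR n * t0) z = phi (INR n * t0) w -> z = w).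
Proof.
intros H Ht0 Hm Hi n. induction n as [|n [IH1 IH2]].
- rewrite Rmult_0_l. split.
  + apply (mobius_ext (fun z => z)).
    * intros z Hz. symmetry. now apply (semigroup_zero _ H).
    * exists 1%C, 0%C, 0%C, 1%C. intros z _. replace (0 * z + 1)%C with (RtoC 1) by ring.
      split; [apply C1_nz|ring].
  + intros z w Hz Hw E. now rewrite !(semigroup_zero _ H) in E by trivial.
- rewrite S_INR. replace ((INR n + 1) * t0) with (t0 + INR n * t0) by ring.
  assert (Pn : 0 <= INR n * t0) by (assert (P := pos_INR n); nra).
  assert (E : forall z, Cmod z < 1 -> phi (t0 + INR n * t0) z = phi t0 (phi (INR n * t0) z)).
  { intros z Hz. now apply (semigroup_add _ H). }
  assert (Hd := semigroup_self_map _ H _ Pn). split.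
  + apply (mobius_ext (fun z => phi t0 (phi (INR n * t0) z))).
    * intros z Hz. now rewrite E.
    * now apply mobius_comp.
  + intros z w Hz Hw Ezw. rewrite !E in Ezw by trivial. apply IH2; trivial. apply Hi; trivial; now apply Hd.
Qed.

Theorem theorem0p3 (phi : R -> C -> C) (hphi : continuous_semigroup phi)
  (hlf : exists t0 : R, 0 < t0 /\ linear_fractional_self_map (phi t0)) :
  forall t : R, 0 <= t -> linear_fractional_self_map (phi t).
Proof.
intros t Ht. destruct hlf as [t0 [Ht0 Hlf]].
destruct (mobius_of_linear_fractional _ Hlf) as [Hm0 Hi0].
destruct (INR_unbounded (t / t0)) as [n Hn].
assert (Hnt : t <= INR n * t0) by (apply Rlt_div_l in Hn; lra).
destruct (semigroup_multiple phi t0 hphi (Rlt_le _ _ Ht0) Hm0 Hi0 n) as [Hm Hi].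
set (s := INR n * t0 - t). assert (Hs : 0 <= s) by (unfold s; lra).
assert (Hd := fun u Hu => semigroup_self_map _ hphi u Hu).
assert (Hdiff : forall u, 0 <= u -> forall z, Cmod z < 1 -> cdiff (phi u) z).
{ intros u Hu z Hz. apply cdiff_of_ex_derive. now apply (semigroup_holomorphic _ hphi). }
assert (F : mobius_factorization (phi t) (phi s) (phi (INR n * t0))).
{ split; auto.
  - intros z Hz. rewrite <- (semigroup_add _ hphi) by trivial. f_equal. unfold s. ring.
  - intros z Hz. rewrite <- (semigroup_add _ hphi) by trivial. f_equal. unfold s. ring. }
apply linear_fractional_of_mobius; auto.
- now apply (mobius_root _ _ _ F).
- intros z w Hz Hw E. apply Hi; trivial.
  now rewrite <- !(fact_gf _ _ _ F), E by trivial.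
Qed.
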